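(* Let $\mathcal{N}$ be the basic Cohen model. In $\mathcal{N}$ the maximum principle fails for the partial order $\mathrm{Inj}(\omega,\omega)$.
   Context: Basic Cohen model. Let $M$ be a countable standard transitive model of ZFC. In $M$ let $\mathbb{P}=Fn(\omega\times\omega,2,\omega)$ be the poset of finite partial functions $p:D\to 2$, $D\subseteq\omega\times\omega$ finite, ordered by reverse inclusion. Each bijection $\tilde\pi:\omega\to\omega$ induces an automorphism $\pi$ of $\mathbb{P}$: for $p:D\to2$, $\pi(p)$ has domain $\{(\tilde\pi(i),j):(i,j)\in D\}$ and $\pi(p)(\tilde\pi(i),j)=p(i,j)$. Automorphisms act on $\mathbb{P}$-names by $\pi(\tau)=\{(\pi(p),\pi(\sigma)):(p,\sigma)\in\tau\}$. Let $\mathcal{G}$ be the group of automorphisms of $\mathbb{P}$ generated by $\{\pi_{i,j}: i<j<\omega\}$, where $\tilde\pi_{i,j}$ swaps $i$ and $j$ and fixes everything else. Let $H_n=\{\pi\in\mathcal{G}:\tilde\pi\upharpoonright n=\mathrm{id}\}$, and let $\mathcal{F}$ be the normal filter of subgroups of $\mathcal{G}$ generated by $\{H_n:n<\omega\}$. A $\mathbb{P}$-name $\tau\in M$ is symmetric if for some $n$ every $\pi\in H_n$ satisfies $\pi(\tau)=\tau$; it is hereditarily symmetric if it is symmetric and every $\sigma$ with $(p,\sigma)\in\tau$ for some $p$ is hereditarily symmetric. For $G$ $\mathbb{P}$-generic over $M$, the symmetric model $\mathcal{N}=\mathcal{N}_G=\{\tau^G:\tau\in M\text{ a hereditarily symmetric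 }\mathbb{P}\text{-name}\}$, a model of ZF with $M\subseteq\mathcal{N}\subseteq M[G]$, is the basic Cohen model. For infinite sets $I,J$, $\mathrm{Inj}(I,J)$ is the partial order of all finite injective partial maps from $I$ to $J$ (finite $r\subseteq I\times J$ that are graphs of one-to-one functions), ordered by reverse inclusion: $r_1\unlhd r_2$ iff $r_1\supseteq r_2$. For a partial order $\mathbb{Q}=(\mathbb{Q},\unlhd)$ the maximum principle for $\mathbb{Q}$ says: for every $p\in\mathbb{Q}$ and every formula $\theta(x)$ of set theory with $\mathbb{Q}$-names as parameters, $p\Vdash\exists x\,\theta(x)$ iff there exists a $\mathbb{Q}$-name $\tau$ with $p\Vdash\theta(\tau)$. Here $\Vdash$ is the usual forcing relation, defined in ZF without choice, with existential clause: $p\Vdash\exists x\,\theta(x)$ iff $\forall q\unlhd p\;\exists r\unlhd q\;\exists\tau$ a $\mathbb{Q}$-name with $r\Vdash\theta(\tau)$. ''In $\mathcal{N}$'' means that names and the forcing relation are those of $\mathcal{N}$; the principle fails for $\mathbb{Q}$ if some instance of it fails. *)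

(* Defs.v *)
(* Plain Rocq with the Standard Library; classical logic and choice in the metatheory. *)
From Stdlib Require Import Classical ClassicalEpsilon FunctionalExtensionality
  PropExtensionality List Wellfounded Relation_Operators PeanoNat.

Set Implicit Arguments.

(** * The ambient universe of sets *)

(** Aczel's well-founded trees; [V] is the type of canonical representatives of
    trees modulo bisimilarity, so that set equality is Leibniz equality. *)
Inductive Ens : Type := sup (A : Type) (f : A -> Ens).

Fixpoint Equ (x y : Ens) : Prop :=
  match x, y with
  | @sup A f, @sup B g =>
      (forall a, exists b, Equ (f a) (g b)) /\ (forall b, exists a, Equ (f a) (g b))
  end.

Lemma Equ_refl x : Equ x x.
Proof. induction x as [A f IH]; simpl; split; intro a; exists a; apply IH. Qed.

Lemma Equ_sym x y : Equ x y -> Equ y x.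
Proof.
revert y; induction x as [A f IH]; intros [B g] [H1 H2]; simpl; split.
- intro b; destruct (H2 b) as [a Ha]; exists a; auto.
- intro a; destruct (H1 a) as [b Hb]; exists b; auto.
Qed.

Lemma Equ_trans x y z : Equ x y -> Equ y z -> Equ x z.
Proof.
revert y z; induction x as [A f IH]; intros [B g] [C h] [H1 H2] [K1 K2]; simpl; split.
- intro a; destruct (H1 a) as [b Hb], (K1 b) as [c Hc]; exists c; eauto.
- intro c; destruct (K2 c) as [b Hb], (H2 b) as [a Ha]; exists a; eauto.
Qed.

Definition canon (x : Ens) : Ens := epsilon (inhabits x) (Equ x).

Lemma canon_Equ x : Equ x (canon x).
Proof. exact (epsilon_spec (inhabits x) (Equ x) (ex_intro _ x (Equ_refl x))). Qed.

Lemma canon_eq x y : Equ x y -> canon x = canon y.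
Proof.
intro H.
assert (E : Equ x = Equ y).
{ extensionality z; apply propositional_extensionality; split;
    eauto using Equ_trans, Equ_sym. }
unfold canon; rewrite E; f_equal; apply proof_irrelevance.
Qed.

Definition V : Type := {x : Ens | canon x = x}.

Definition cls (x : Ens) : V := exist _ (canon x) (eq_sym (canon_eq _ _ (canon_Equ x))).

Definition mem (x y : V) : Prop :=
  match proj1_sig y with sup f => exists a, Equ (proj1_sig x) (f a) end.

Declare Scope set_scope.
Notation "x ∈ y" := (mem x y) (at level 70) : set_scope.
Open Scope set_scope.

Definition subset (x y : V) : Prop := forall z, z ∈ x -> z ∈ y.
Notation "x ⊆ y" := (subset x y) (at level 70) : set_scope.

Lemma V_eq (x y : V) : Equ (proj1_sig x) (proj1_sig y) -> x = y.
Proof.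
destruct x as [x Hx], y as [y Hy]; simpl; intro H.
assert (E : x = y) by (rewrite <- Hx, <- Hy; apply canon_eq; exact H).
subst y; f_equal; apply proof_irrelevance.
Qed.

Lemma mem_cls (z : V) A (f : A -> Ens) :
  z ∈ cls (sup f) <-> exists a, z = cls (f a).
Proof.
unfold mem; simpl.
pose proof (canon_Equ (sup f)) as H; destruct (canon (sup f)) as [B g]; destruct H as [H1 H2].
split.
- intros [b Hb]; destruct (H2 b) as [a Ha]; exists a; apply V_eq; simpl.
  eapply Equ_trans; [exact Hb|]; eapply Equ_trans; [apply Equ_sym; exact Ha|apply canon_Equ].
- intros [a ->]; destruct (H1 a) as [b Hb]; exists b; simpl.
  eapply Equ_trans; [apply Equ_sym, canon_Equ|exact Hb].
Qed.

Lemma set_of_family A (f : A -> V) : exists x, forall z, z ∈ x <-> exists a, z = f a.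
Proof.
exists (cls (sup (fun a => proj1_sig (f a)))); intro z; rewrite mem_cls.
assert (E : forall a, cls (proj1_sig (f a)) = f a)
  by (intro a; apply V_eq; simpl; apply Equ_sym, canon_Equ).
split; intros [a ->]; exists a; rewrite E; reflexivity.
Qed.

Lemma family_of_set (x : V) : exists A (f : A -> V), forall z, z ∈ x <-> exists a, z = f a.
Proof.
destruct x as [[A f] Hx]; exists A, (fun a => cls (f a)); intro z; unfold mem; simpl; split.
- intros [a Ha]; exists a; apply V_eq; simpl; eapply Equ_trans; [exact Ha|apply canon_Equ].
- intros [a ->]; exists a; simpl; apply Equ_sym, canon_Equ.
Qed.

Lemma set_ext (x y : V) : (forall z, z ∈ x <-> z ∈ y) -> x = y.
Proof.
intro H; apply V_eq.
destruct x as [[A f] Hx], y as [[B g] Hy]; simpl; split.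
- intro a; destruct (proj1 (H (cls (f a)))) as [b Hb]; simpl in *.
  + exists a; apply Equ_sym, canon_Equ.
  + exists b; eapply Equ_trans; [apply canon_Equ|exact Hb].
- intro b; destruct (proj2 (H (cls (g b)))) as [a Ha]; simpl in *.
  + exists b; apply Equ_sym, canon_Equ.
  + exists a; apply Equ_sym; eapply Equ_trans; [apply canon_Equ|exact Ha].
Qed.

Lemma mem_wf : well_founded mem.
Proof.
assert (H : forall (t : Ens) (x : V), Equ (proj1_sig x) t -> Acc mem x).
{ induction t as [A f IH]; intros x Hx; constructor; intros y Hy.
  unfold mem in Hy; destruct (proj1_sig x) as [B g]; destruct Hx as [Hx _].
  destruct Hy as [b Hb], (Hx b) as [a Ha]; apply (IH a); eapply Equ_trans; eauto. }
intro x; apply (H (proj1_sig x)); apply Equ_refl.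
Qed.

(** * Comprehension and basic set operations *)

Definition empty : V := cls (sup (fun a : Empty_set => match a with end)).

(** [{{ x | P }}] is the set of all [x] satisfying [P]; it is an unspecified set
    when these form a proper class, which [small P] rules out. *)
Definition compr (P : V -> Prop) : V :=
  epsilon (inhabits empty) (fun x => forall z, z ∈ x <-> P z).
Notation "{{ x | P }}" := (compr (fun x => P)) (at level 0, x name) : set_scope.

Definition small (P : V -> Prop) : Prop :=
  exists A (f : A -> V), forall z, P z -> exists a, z = f a.

Lemma in_compr P : small P -> forall z, z ∈ compr P <-> P z.
Proof.
intros (A & f & Hf); unfold compr; apply epsilon_spec.
destruct (set_of_family (fun a : {a : A | P (f a)} => f (proj1_sig a))) as [x Hx].
exists x; intro z; rewrite Hx; split.
- intros [[a Ha] ->]; exact Ha.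
- intro Hz; destruct (Hf z Hz) as [a ->]; exists (exist _ a Hz); reflexivity.
Qed.

Lemma small_mem x : small (fun z => z ∈ x).
Proof.
destruct (family_of_set x) as (A & f & Hf); exists A, f; intros z Hz; apply Hf; exact Hz.
Qed.

Lemma small_sub (P Q : V -> Prop) : (forall z, P z -> Q z) -> small Q -> small P.
Proof. intros H (A & f & Hf); exists A, f; auto. Qed.

Lemma small_repl (P : V -> Prop) (R : V -> V -> Prop) :
  small P -> (forall y z z', R y z -> R y z' -> z = z') ->
  small (fun z => exists y, P y /\ R y z).
Proof.
intros (A & f & Hf) HR; exists A, (fun a => epsilon (inhabits empty) (R (f a))).
intros z (y & Hy & Hz); destruct (Hf y Hy) as [a ->]; exists a.
apply (HR (f a)); [exact Hz|]; apply epsilon_spec; exists z; exact Hz.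
Qed.

Lemma small_subset x : small (fun z => z ⊆ x).
Proof.
destruct (family_of_set x) as (A & f & Hf).
exists (A -> Prop), (fun S => {{ z | exists a, S a /\ z = f a }}).
intros z Hz; exists (fun a => f a ∈ z); apply set_ext; intro w; rewrite in_compr.
- split.
  + intro Hw; destruct (proj1 (Hf w) (Hz w Hw)) as [a ->]; exists a; auto.
  + intros (a & Ha & ->); exact Ha.
- exists A, f; intros u (a & _ & ->); exists a; reflexivity.
Qed.

Definition upair (x y : V) : V := {{ z | z = x \/ z = y }}.
Definition pair (x y : V) : V := upair (upair x x) (upair x y).
Notation "⟨ x , y ⟩" := (pair x y) (at level 0, format "⟨ x ,  y ⟩") : set_scope.
Definition prod (x y : V) : V := {{ z | exists a b, a ∈ x /\ b ∈ y /\ z = ⟨a, b⟩ }}.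

Fixpoint num (n : nat) : V :=
  match n with
  | O => empty
  | S n => {{ z | z ∈ num n \/ z = num n }}
  end.
Definition omega : V := {{ z | exists n, z = num n }}.

Lemma in_upair x y z : z ∈ upair x y <-> z = x \/ z = y.
Proof.
apply in_compr; exists bool, (fun b : bool => if b then x else y).
intros w [->| ->]; [exists true|exists false]; reflexivity.
Qed.

Lemma pair_inj a b c d : ⟨a, b⟩ = ⟨c, d⟩ -> a = c /\ b = d.
Proof.
intro H.
assert (K : forall x y z, z ∈ ⟨x, y⟩ <-> z = upair x x \/ z = upair x y)
  by (intros; apply in_upair).
assert (U : forall x y z w, upair x y = upair z w ->
  (x = z \/ x = w) /\ (y = z \/ y = w) /\ (z = x \/ z = y) /\ (w = x \/ w = y)).
{ intros x y z w E; repeat split; apply in_upair;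
    [rewrite <- E|rewrite <- E|rewrite E|rewrite E]; apply in_upair; auto. }
assert (H1 : upair a a = upair c c \/ upair a a = upair c d)
  by (apply K; rewrite <- H; apply K; auto).
assert (H2 : upair a b = upair c c \/ upair a b = upair c d)
  by (apply K; rewrite <- H; apply K; auto).
assert (H3 : upair c d = upair a a \/ upair c d = upair a b)
  by (apply K; rewrite H; apply K; auto).
assert (E : a = c).
{ destruct H1 as [E|E]; apply U in E; intuition congruence. }
split; [exact E|]; subst c.
destruct H2 as [E|E], H3 as [F|F]; apply U in E; apply U in F; intuition congruence.
Qed.

Lemma in_prod x y z : z ∈ prod x y <-> exists a b, a ∈ x /\ b ∈ y /\ z = ⟨a, b⟩.
Proof.
destruct (family_of_set x) as (A & f & Hf), (family_of_set y) as (B & g & Hg).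
apply (@in_compr (fun z => exists a b, a ∈ x /\ b ∈ y /\ z = ⟨a, b⟩)).
exists (A * B)%type, (fun c => ⟨f (fst c), g (snd c)⟩).
intros w (a & b & Ha & Hb & ->).
destruct (proj1 (Hf a) Ha) as [i ->], (proj1 (Hg b) Hb) as [j ->]; exists (i, j); reflexivity.
Qed.

Lemma in_empty z : ~ z ∈ empty.
Proof. unfold empty; rewrite mem_cls; intros [[] _]. Qed.

Lemma in_num_S n z : z ∈ num (S n) <-> z ∈ num n \/ z = num n.
Proof.
simpl; apply (@in_compr (fun z => z ∈ num n \/ z = num n)).
destruct (family_of_set (num n)) as (A & f & Hf).
exists (option A), (fun o => match o with Some a => f a | None => num n end).
intros w [Hw| ->]; [|exists None; reflexivity].
destruct (proj1 (Hf w) Hw) as [a ->]; exists (Some a); reflexivity.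
Qed.

Lemma in_omega z : z ∈ omega <-> exists n, z = num n.
Proof. apply in_compr; exists nat, num; auto. Qed.

(** * Finite partial maps and forcing notions *)

Definition finite (x : V) : Prop := exists l : list V, forall z, z ∈ x -> In z l.

Definition single_valued (p : V) : Prop :=
  forall a b b', ⟨a, b⟩ ∈ p -> ⟨a, b'⟩ ∈ p -> b = b'.

Definition one_to_one (p : V) : Prop :=
  forall a a' b, ⟨a, b⟩ ∈ p -> ⟨a', b⟩ ∈ p -> a = a'.

Definition Fn (I J : V) : V :=
  {{ p | finite p /\ p ⊆ prod I J /\ single_valued p }}.

Definition Inj (I J : V) : V :=
  {{ p | finite p /\ p ⊆ prod I J /\ single_valued p /\ one_to_one p }}.

Lemma in_Fn I J p : p ∈ Fn I J <-> finite p /\ p ⊆ prod I J /\ single_valued p.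
Proof.
apply (@in_compr (fun p => finite p /\ p ⊆ prod I J /\ single_valued p)).
apply small_sub with (2 := small_subset (prod I J)); tauto.
Qed.

Lemma in_Inj I J p :
  p ∈ Inj I J <-> finite p /\ p ⊆ prod I J /\ single_valued p /\ one_to_one p.
Proof.
apply (@in_compr (fun p => finite p /\ p ⊆ prod I J /\ single_valued p /\ one_to_one p)).
apply small_sub with (2 := small_subset (prod I J)); tauto.
Qed.

(** [le Q q p] reads "q is stronger than p". *)
Record notion : Type := Notion { cond : V; le : V -> V -> Prop }.

Definition rev_incl (q p : V) : Prop := p ⊆ q.

Definition cohen : notion := Notion (Fn (prod omega omega) (num 2)) rev_incl.
(** All elements of [Inj omega omega] are hereditarily finite, so this set and
    its ordering are the same in every transitive model of ZF. *)
Definition inj_omega : notion := Notion (Inj omega omega) rev_incl.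

Definition dense (Q : notion) (D : V) : Prop :=
  D ⊆ cond Q /\ forall p, p ∈ cond Q -> exists q, q ∈ D /\ le Q q p.

Definition is_filter (Q : notion) (G : V) : Prop :=
  G ⊆ cond Q /\ (exists p, p ∈ G) /\
  (forall p q, p ∈ G -> q ∈ cond Q -> le Q p q -> q ∈ G) /\
  (forall p q, p ∈ G -> q ∈ G -> exists r, r ∈ G /\ le Q r p /\ le Q r q).

Definition generic (M : V -> Prop) (Q : notion) (G : V) : Prop :=
  is_filter Q G /\ forall D, M D -> dense Q D -> exists p, p ∈ D /\ p ∈ G.

(** * Formulas of set theory and models of ZFC *)

(** De Bruijn indices: in [Ex A], index 0 is the bound variable. *)
Inductive formula : Type :=
| Mem (i j : nat)
| Eq (i j : nat)
| And (A B : formula)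
| Not (A : formula)
| Ex (A : formula).

Definition scons (x : V) (e : nat -> V) (n : nat) : V :=
  match n with O => x | S n => e n end.

Fixpoint sat (W : V -> Prop) (A : formula) (e : nat -> V) : Prop :=
  match A with
  | Mem i j => e i ∈ e j
  | Eq i j => e i = e j
  | And A B => sat W A e /\ sat W B e
  | Not A => ~ sat W A e
  | Ex A => exists x, W x /\ sat W A (scons x e)
  end.

Record ZFC_model (M : V -> Prop) : Prop := {
  zfc_extensionality : forall x y, M x -> M y ->
    (forall z, M z -> (z ∈ x <-> z ∈ y)) -> x = y;
  zfc_foundation : forall x, M x -> (exists y, M y /\ y ∈ x) ->
    exists y, M y /\ y ∈ x /\ ~ exists z, M z /\ z ∈ x /\ z ∈ y;
  zfc_pairing : forall x y, M x -> M y ->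
    exists z, M z /\ forall w, M w -> (w ∈ z <-> w = x \/ w = y);
  zfc_union : forall x, M x ->
    exists z, M z /\ forall w, M w -> (w ∈ z <-> exists y, M y /\ y ∈ x /\ w ∈ y);
  zfc_power : forall x, M x ->
    exists z, M z /\ forall w, M w -> (w ∈ z <-> forall u, M u -> u ∈ w -> u ∈ x);
  zfc_infinity : exists x, M x /\
    (exists o, M o /\ o ∈ x /\ forall u, M u -> ~ u ∈ o) /\
    (forall y, M y -> y ∈ x ->
       exists s, M s /\ s ∈ x /\ forall u, M u -> (u ∈ s <-> u ∈ y \/ u = y));
  zfc_separation : forall (A : formula) (e : nat -> V), (forall n, M (e n)) ->
    forall x, M x ->
    exists z, M z /\ forall w, M w -> (w ∈ z <-> w ∈ x /\ sat M A (scons w e));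
  (* index 0 of [A] is the value, index 1 the argument *)
  zfc_replacement : forall (A : formula) (e : nat -> V), (forall n, M (e n)) ->
    forall x, M x ->
    (forall u, M u -> u ∈ x -> exists! v, M v /\ sat M A (scons v (scons u e))) ->
    exists z, M z /\
      forall u, M u -> u ∈ x -> exists v, M v /\ v ∈ z /\ sat M A (scons v (scons u e));
  zfc_choice : forall x, M x ->
    (forall y, M y -> y ∈ x -> exists u, M u /\ u ∈ y) ->
    (forall y y' u, M y -> M y' -> M u ->
       y ∈ x -> y' ∈ x -> u ∈ y -> u ∈ y' -> y = y') ->
    exists c, M c /\ forall y, M y -> y ∈ x -> exists! u, M u /\ u ∈ y /\ u ∈ c
}.

(** A countable class is a set, so taking [M] to be a class loses no generality. *)
Record ctm (M : V -> Prop) : Prop := {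
  ctm_countable : exists s : nat -> V, forall x, M x -> exists n, x = s n;
  ctm_transitive : forall x y, M y -> x ∈ y -> M x;
  ctm_ZFC : ZFC_model M
}.

(** * Names *)

(** A name is a set of pairs [⟨p, σ⟩] with [p] a condition and [σ] a name. *)
Inductive name (Q : notion) : V -> Prop :=
| name_intro t :
    (forall x, x ∈ t -> exists p s, p ∈ cond Q /\ name Q s /\ x = ⟨p, s⟩) -> name Q t.

Definition subname (s t : V) : Prop := exists p, ⟨p, s⟩ ∈ t.

Lemma subname_wf : well_founded subname.
Proof.
apply wf_incl with (R2 := clos_trans V mem); [|apply wf_clos_trans, mem_wf].
intros s t [p Hp]; apply t_trans with (y := ⟨p, s⟩); [|apply t_step; exact Hp].
apply t_trans with (y := upair p s); apply t_step; apply in_upair; auto.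
Qed.

(** The evaluation [t^G], characterised by [in_val] below. *)
Definition val (G : V) : V -> V :=
  Fix subname_wf (fun _ => V) (fun t rec =>
    {{ x | exists p s (h : subname s t), ⟨p, s⟩ ∈ t /\ p ∈ G /\ x = rec s h }}).

Lemma in_val G t x :
  x ∈ val G t <-> exists p s, ⟨p, s⟩ ∈ t /\ p ∈ G /\ x = val G s.
Proof.
unfold val at 1; rewrite Fix_eq; fold (val G).
2:{ intros u f g H; f_equal; extensionality z; apply propositional_extensionality.
    split; intros (p & s & h & H1 & H2 & ->); exists p, s, h; rewrite H; auto. }
rewrite in_compr.
- split; [intros (p & s & h & H); exists p, s; exact H|].
  intros (p & s & H); exists p, s, (ex_intro _ p (proj1 H)); exact H.
- apply small_sub with
    (Q := fun z => exists y, y ∈ t /\ exists p s, y = ⟨p, s⟩ /\ z = val G s).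
  + intros z (p & s & _ & H1 & _ & H2); exists ⟨p, s⟩; split; [exact H1|].
    exists p, s; auto.
  + apply small_repl; [apply small_mem|].
    intros y z z' (p & s & -> & ->) (p' & s' & E & ->).
    destruct (pair_inj _ _ _ _ E) as [_ ->]; reflexivity.
Qed.

(** * The group acting on the Cohen poset *)

Definition swap (i j n : nat) : nat :=
  if Nat.eqb n i then j else if Nat.eqb n j then i else n.

(** An automorphism [π] in the group is represented by the permutation [π~] of [ω]
    inducing it; [π~] determines [π] and conversely. *)
Inductive in_group : (nat -> nat) -> Prop :=
| group_gen i j : i < j -> in_group (swap i j)
| group_id : in_group (fun n => n)
| group_comp f g : in_group f -> in_group g -> in_group (fun n => f (g n))
| group_inv f g : in_group f ->
    (forall n, f (g n) = n) -> (forall n, g (f n) = n) -> in_group g.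

Definition H_sub (n : nat) (f : nat -> nat) : Prop :=
  in_group f /\ forall k, k < n -> f k = k.

Definition act_cond (f : nat -> nat) (p : V) : V :=
  {{ x | exists i j b, ⟨⟨num i, num j⟩, b⟩ ∈ p /\ x = ⟨⟨num (f i), num j⟩, b⟩ }}.

(** The action on names, characterised by [in_act] below. *)
Definition act (f : nat -> nat) : V -> V :=
  Fix subname_wf (fun _ => V) (fun t rec =>
    {{ x | exists p s (h : subname s t), ⟨p, s⟩ ∈ t /\ x = ⟨act_cond f p, rec s h⟩ }}).

Lemma num_inj m n : num m = num n -> m = n.
Proof.
assert (L : forall k l, k < l -> num k ∈ num l).
{ intros k l; induction 1 as [|l _ IH]; apply in_num_S; auto. }
assert (I : forall x, ~ x ∈ x).
{ intro x; induction (mem_wf x) as [x _ IH]; intro Hx; exact (IH x Hx Hx). }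
intro E; destruct (Nat.lt_total m n) as [K|[K|K]]; [|exact K|];
  apply L in K; rewrite E in K; destruct (I _ K).
Qed.

Lemma in_act_cond f p x :
  x ∈ act_cond f p <->
  exists i j b, ⟨⟨num i, num j⟩, b⟩ ∈ p /\ x = ⟨⟨num (f i), num j⟩, b⟩.
Proof.
apply (@in_compr (fun x =>
  exists i j b, ⟨⟨num i, num j⟩, b⟩ ∈ p /\ x = ⟨⟨num (f i), num j⟩, b⟩)).
apply small_sub with (Q := fun z => exists y, y ∈ p /\
  exists i j b, y = ⟨⟨num i, num j⟩, b⟩ /\ z = ⟨⟨num (f i), num j⟩, b⟩).
- intros z (i & j & b & H1 & H2); eexists; split; [exact H1|]; exists i, j, b; auto.
- apply small_repl; [apply small_mem|].
  intros y z z' (i & j & b & -> & ->) (i' & j' & b' & E & ->).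
  destruct (pair_inj _ _ _ _ E) as [E1 <-]; destruct (pair_inj _ _ _ _ E1) as [E2 <-].
  rewrite (num_inj _ _ E2); reflexivity.
Qed.

Lemma in_act f t x :
  x ∈ act f t <-> exists p s, ⟨p, s⟩ ∈ t /\ x = ⟨act_cond f p, act f s⟩.
Proof.
unfold act at 1; rewrite Fix_eq; fold (act f).
2:{ intros u g g' K; f_equal; extensionality z; apply propositional_extensionality.
    split; intros (p & s & h & H1 & ->); exists p, s, h; rewrite K; auto. }
rewrite in_compr.
- split; [intros (p & s & h & K); exists p, s; exact K|].
  intros (p & s & K); exists p, s, (ex_intro _ p (proj1 K)); exact K.
- apply small_sub with
    (Q := fun z => exists y, y ∈ t /\
       exists p s, y = ⟨p, s⟩ /\ z = ⟨act_cond f p, act f s⟩).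
  + intros z (p & s & _ & H1 & H2); exists ⟨p, s⟩; split; [exact H1|].
    exists p, s; auto.
  + apply small_repl; [apply small_mem|].
    intros y z z' (p & s & -> & ->) (p' & s' & E & ->).
    destruct (pair_inj _ _ _ _ E) as [-> ->]; reflexivity.
Qed.

Definition symmetric (t : V) : Prop := exists n, forall f, H_sub n f -> act f t = t.

Inductive hereditarily_symmetric : V -> Prop :=
| hs_intro t : symmetric t ->
    (forall p s, ⟨p, s⟩ ∈ t -> hereditarily_symmetric s) -> hereditarily_symmetric t.

Definition basic_cohen_model (M : V -> Prop) (G : V) (x : V) : Prop :=
  exists t, M t /\ name cohen t /\ hereditarily_symmetric t /\ x = val G t.

(** * The forcing relation of a transitive model *)

(** The recursion of Kunen, "Set Theory" (1980), VII.3.3.  Names being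
    well-founded, the least fixed point is the only one.  The atomic clauses
    quantify over conditions and elements of names only, so they do not depend
    on the transitive model in which they are evaluated. *)
Inductive forces_eq (Q : notion) : V -> V -> V -> Prop :=
| forces_eq_intro p t1 t2 :
    (forall p1 s1, ⟨p1, s1⟩ ∈ t1 ->
       forall q, q ∈ cond Q -> le Q q p ->
       exists r, r ∈ cond Q /\ le Q r q /\
         (le Q r p1 -> exists p2 s2, ⟨p2, s2⟩ ∈ t2 /\ le Q r p2 /\ forces_eq Q r s1 s2)) ->
    (forall p2 s2, ⟨p2, s2⟩ ∈ t2 ->
       forall q, q ∈ cond Q -> le Q q p ->
       exists r, r ∈ cond Q /\ le Q r q /\
         (le Q r p2 -> exists p1 s1, ⟨p1, s1⟩ ∈ t1 /\ le Q r p1 /\ forces_eq Q r s1 s2)) ->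
    forces_eq Q p t1 t2.

Definition forces_mem (Q : notion) (p t1 t2 : V) : Prop :=
  forall q, q ∈ cond Q -> le Q q p ->
  exists r, r ∈ cond Q /\ le Q r q /\
    exists p2 s2, ⟨p2, s2⟩ ∈ t2 /\ le Q r p2 /\ forces_eq Q r t1 s2.

Definition name_in (W : V -> Prop) (Q : notion) (t : V) : Prop := W t /\ name Q t.

(** [forces W Q A p e]: in the sense of [W], the condition [p] forces [A] with the
    names [e] substituted for its free variables. *)
Fixpoint forces (W : V -> Prop) (Q : notion) (A : formula) (p : V) (e : nat -> V) : Prop :=
  match A with
  | Mem i j => forces_mem Q p (e i) (e j)
  | Eq i j => forces_eq Q p (e i) (e j)
  | And A B => forces W Q A p e /\ forces W Q B p e
  | Not A => forall q, q ∈ cond Q -> le Q q p -> ~ forces W Q A q e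
  | Ex A => forall q, q ∈ cond Q -> le Q q p ->
      exists r, r ∈ cond Q /\ le Q r q /\
        exists t, name_in W Q t /\ forces W Q A r (scons t e)
  end.

Definition maximum_principle (W : V -> Prop) (Q : notion) : Prop :=
  forall (p : V) (A : formula) (e : nat -> V),
    p ∈ cond Q -> (forall n, name_in W Q (e n)) ->
    (forces W Q (Ex A) p e <->
     exists t, name_in W Q t /\ forces W Q A p (scons t e)).

(* Main.v *)
(** Write [a_i] for the [i]-th Cohen real and [g] for the generic injection added by
    [Inj(ω, ω)].  The failing instance is [∃ x, x ∈ Y], where [Y] is a name for the set of
    Cohen reals [a_i] with [g(0) ∈ a_i].  The existential statement is forced, because
    every condition extends to one that decides [g(0)], and every [n] lies in some [a_i].

    Suppose some name in [N], the value of a Cohen name [x] fixed by [H_k], were forced to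
    belong to [Y].  Choose [n] outside [a_0], ..., [a_(k-1)] and a condition [r] that puts
    [g(0) = n] and decides the name to be [a_i]; then [i >= k].  Let [H] contain [r] and be
    [Inj]-generic over [M[G]].  Then [x], evaluated by [G] and then by [H], is [a_i], and
    this is forced over [M] by some [(p, b)] in [G × H].  By genericity there is [j > i]
    such that the transposition [π] of [i] and [j] satisfies [π p ∈ G].  Now [πG × H] is
    generic and contains [(p, b)], so evaluating by [πG] and [H] gives [a_j] for the name of
    [a_i], but still [a_i] for [x], since [π x = x].  Hence [a_i = a_j], a contradiction.

    The only truth lemma required is the one for equality of two evaluated names.  The
    first evaluation is that of Cohen names, the second that of labelled graphs over the
    product poset, and [graph_equality] covers both. *)

From Stdlib Require Import Classical ClassicalEpsilon FunctionalExtensionality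
  PropExtensionality List PeanoNat Lia Cantor.
Require Import Defs.

Set Implicit Arguments.
Unset Strict Implicit.

(** * Definability over a countable transitive model *)

(** The matrix of the failing instance is atomic, so the argument takes place in [forces_eq] and
    [forces_mem], whose clauses are read in the ambient universe. Genericity of H over M[G] is split
    into the two facts that are used: the product of G and H is generic over M, and H meets the
    countably many dense sets that give [forces_eq] its meaning on values of names from M. The
    latter may be arbitrary predicates, as H is built from an enumeration of M.

    The product matters because the symmetry moves only its first coordinate. The equation between x
    and a_i has to be decided by one pair (p, b) for all product-generic filters at once, with b
    untouched by the swap. This is what the truth lemma over M serves. It concerns values of values,
    since an [Inj]-name of N is itself the value of a Cohen name.

    What M must contain for this comes from separation and replacement. Predicates are stated about
    the true universe and shown to agree with a formula over M, so that definability and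
    absoluteness are settled together. *)

Definition shift (e : nat -> V) (n : nat) : V := e (S n).

Definition up (f : nat -> nat) (n : nat) : nat :=
  match n with O => O | S n => S (f n) end.

Fixpoint ren (f : nat -> nat) (A : formula) : formula :=
  match A with
  | Mem i j => Mem (f i) (f j)
  | Eq i j => Eq (f i) (f j)
  | And A B => And (ren f A) (ren f B)
  | Not A => Not (ren f A)
  | Ex A => Ex (ren (up f) A)
  end.

Lemma sat_ren W A : forall f e, sat W (ren f A) e <-> sat W A (fun n => e (f n)).
Proof.
induction A as [i j|i j|A IHA B IHB|A IHA|A IHA]; intros f e; simpl.
- reflexivity.
- reflexivity.
- rewrite IHA, IHB; reflexivity.
- rewrite IHA; reflexivity.
- assert (E : forall x, (fun n => scons x e (up f n)) = scons x (fun n => e (f n)))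
    by (intro x; extensionality n; destruct n; reflexivity).
  split; intros (x & Hx & K); exists x; (split; [exact Hx|]);
    [rewrite <- E; apply IHA; exact K|apply IHA; rewrite E; exact K].
Qed.

(** Identifies a comprehension with a set already found, usually one produced inside [M]; the
    existence of [Z] replaces a proof of smallness. *)
Lemma compr_eq (P : V -> Prop) Z : (forall z, z ∈ Z <-> P z) -> compr P = Z.
Proof.
intro H; apply set_ext; intro z; rewrite (H z); revert z.
unfold compr; apply epsilon_spec; exists Z; exact H.
Qed.

Lemma empty_subset x : empty ⊆ x.
Proof. intros z Hz; destruct (in_empty _ Hz). Qed.

Lemma subset_antisym x y : x ⊆ y -> y ⊆ x -> x = y.
Proof. intros H1 H2; apply set_ext; intro z; split; auto. Qed.

Definition enumeration (M : V -> Prop) : nat -> V :=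
  epsilon (inhabits (fun _ => empty))
    (fun c => (forall n, M (c n)) /\ forall x, M x -> exists n, x = c n).

Section Model.

Variable M : V -> Prop.
Variable hM : ctm M.

Local Notation enum := (enumeration M).

Lemma M_trans x y : M y -> x ∈ y -> M x.
Proof. exact (ctm_transitive hM x y). Qed.

Lemma M_inhabited : exists x, M x.
Proof. destruct (zfc_infinity (ctm_ZFC hM)) as (x & Hx & _); exists x; exact Hx. Qed.

Lemma enumeration_spec : (forall n, M (enum n)) /\ forall x, M x -> exists n, x = enum n.
Proof.
unfold enumeration; apply epsilon_spec.
destruct (ctm_countable hM) as [s Hs], M_inhabited as [x0 Hx0].
(* Countability only provides a sequence covering [M]; its terms outside [M] are replaced by the
   fixed element [x0]. *)
exists (fun n => if excluded_middle_informative (M (s n)) then s n else x0); split.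
- intro n; destruct (excluded_middle_informative (M (s n))); assumption.
- intros x Hx; destruct (Hs x Hx) as [n ->]; exists n.
  destruct (excluded_middle_informative (M (s n))); [reflexivity|contradiction].
Qed.

Definition inM (e : nat -> V) : Prop := forall n, M (e n).

Lemma inM_scons x e : M x -> inM e -> inM (scons x e).
Proof. intros Hx He [|n]; simpl; auto. Qed.

(** Interleaving the variables with an enumeration of the whole countable model makes
    every element of the model available as a parameter. *)
Definition mix (e : nat -> V) (n : nat) : V :=
  if Nat.even n then e (Nat.div2 n) else enum (Nat.div2 n).

Lemma mix_even e n : mix e (2 * n) = e n.
Proof. unfold mix; rewrite Nat.even_even, Nat.div2_double; reflexivity. Qed.

Lemma mix_odd e n : mix e (S (2 * n)) = enum n.
Proof.
unfold mix; rewrite Nat.div2_succ_double, <- Nat.negb_odd, <- Nat.add_1_r, Nat.odd_odd.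
reflexivity.
Qed.

Lemma parity n : (exists k, n = 2 * k) \/ exists k, n = S (2 * k).
Proof.
destruct (Nat.Even_or_Odd n) as [[k Hk]|[k Hk]]; [left|right]; exists k; lia.
Qed.

Lemma inM_mix e : inM e -> inM (mix e).
Proof.
intros He n; destruct (parity n) as [[k ->]|[k ->]].
- rewrite mix_even; apply He.
- rewrite mix_odd; apply enumeration_spec.
Qed.

(** Semantic definability: [P] speaks about the true universe and need agree with the formula only
    on environments from [M]. Even indices of [mix] carry the variables and odd ones the parameters,
    so parameters never appear explicitly. *)
Definition definable (P : (nat -> V) -> Prop) : Prop :=
  exists A, forall e, inM e -> (sat M A (mix e) <-> P e).

Lemma def_ext (P Q : (nat -> V) -> Prop) :
  definable P -> (forall e, inM e -> (P e <-> Q e)) -> definable Q.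
Proof. intros [A HA] H; exists A; intros e He; rewrite HA, H; auto; reflexivity. Qed.

Lemma def_and P Q : definable P -> definable Q -> definable (fun e => P e /\ Q e).
Proof. intros [A HA] [B HB]; exists (And A B); intros e He; simpl; rewrite HA, HB; tauto. Qed.

Lemma def_not P : definable P -> definable (fun e => ~ P e).
Proof. intros [A HA]; exists (Not A); intros e He; simpl; rewrite HA; tauto. Qed.

Lemma def_or P Q : definable P -> definable Q -> definable (fun e => P e \/ Q e).
Proof.
intros HP HQ; apply (def_ext (def_not (def_and (def_not HP) (def_not HQ)))).
intros e _; tauto.
Qed.

Lemma def_imp P Q : definable P -> definable Q -> definable (fun e => P e -> Q e).
Proof.
intros HP HQ; apply (def_ext (def_or (def_not HP) HQ)); intros e _; tauto.
Qed.

Lemma def_iff P Q : definable P -> definable Q -> definable (fun e => P e <-> Q e).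
Proof. intros HP HQ; apply def_and; apply def_imp; assumption. Qed.

Lemma def_ren f P : definable P -> definable (fun e => P (fun n => e (f n))).
Proof.
intros [A HA].
(* Only the even indices are renamed; the odd ones are parameters and stay in place. *)
exists (ren (fun n => if Nat.even n then 2 * f (Nat.div2 n) else n) A).
intros e He; rewrite sat_ren, <- HA by (intro n; apply He).
assert (E : (fun n => mix e (if Nat.even n then 2 * f (Nat.div2 n) else n)) =
            mix (fun n => e (f n))).
{ extensionality n; unfold mix at 2; destruct (Nat.even n) eqn:Hn.
  - apply mix_even.
  - unfold mix; rewrite Hn; reflexivity. }
rewrite E; reflexivity.
Qed.

Lemma def_exM (P : V -> (nat -> V) -> Prop) :
  definable (fun e => P (e 0) (shift e)) -> definable (fun e => exists x, M x /\ P x e).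
Proof.
intros [A HA].
(* The quantifier puts [x] in front of the mixture, while [A] expects [x] mixed in. Beyond index 0,
   variables are therefore found one place lower and parameters one place higher. *)
exists (Ex (ren (fun n => match n with O => O | S O => 2 |
                          S (S n) => if Nat.even n then S n else S (S (S n)) end) A)).
intros e He; simpl.
assert (E : forall x, (fun n => scons x (mix e) (match n with O => O | S O => 2 |
                          S (S n) => if Nat.even n then S n else S (S (S n)) end)) =
            mix (scons x e)).
{ intro x; extensionality n; destruct n as [|[|n]]; try reflexivity.
  unfold mix; simpl; destruct (Nat.even n) eqn:Hn; simpl; rewrite Hn; reflexivity. }
split; intros (x & Hx & K); exists x; (split; [exact Hx|]).
- rewrite sat_ren, E, HA in K by (apply inM_scons; assumption); exact K.
- rewrite sat_ren, E, HA by (apply inM_scons; assumption); exact K.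
Qed.

(** Here, and dually in [def_all], the second hypothesis is the absoluteness that makes an
    unrestricted quantifier agree with the one relativised to [M]. *)
Lemma def_ex (P : V -> (nat -> V) -> Prop) :
  definable (fun e => P (e 0) (shift e)) ->
  (forall e x, inM e -> P x e -> M x) -> definable (fun e => exists x, P x e).
Proof.
intros H K; apply (def_ext (def_exM H)); intros e He; split.
- intros (x & _ & Hx); exists x; exact Hx.
- intros (x & Hx); exists x; eauto.
Qed.

Lemma def_allM (P : V -> (nat -> V) -> Prop) :
  definable (fun e => P (e 0) (shift e)) -> definable (fun e => forall x, M x -> P x e).
Proof.
intro H.
apply (def_ext (def_not (def_exM (P := fun x e => ~ P x e) (def_not H)))).
intros e _; split.
- intros K x Hx; apply NNPP; intro; apply K; exists x; auto.
- intros K (x & Hx & Hn); auto.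
Qed.

Lemma def_all (P : V -> (nat -> V) -> Prop) :
  definable (fun e => P (e 0) (shift e)) ->
  (forall e x, inM e -> ~ M x -> P x e) -> definable (fun e => forall x, P x e).
Proof.
intros H K; apply (def_ext (def_allM H)); intros e He; split; [|auto].
intros L x; destruct (classic (M x)); auto.
Qed.

(** The language has no function symbols, so a term is given by its definable graph; [def_sub]
    eliminates it through an existential quantifier over [M]. *)
Definition dterm (t : (nat -> V) -> V) : Prop :=
  (forall e, inM e -> M (t e)) /\ definable (fun e => e 0 = t (shift e)).

Lemma dterm_ren f t : dterm t -> dterm (fun e => t (fun n => e (f n))).
Proof.
intros [H1 H2]; split; [intros e He; apply H1; intro; apply He|].
exact (def_ren (up f) H2).
Qed.

Lemma dterm_shift t : dterm t -> dterm (fun e => t (shift e)).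
Proof. exact (@dterm_ren S t). Qed.

Lemma dterm_var i : dterm (fun e => e i).
Proof.
split; [auto|]; exists (Eq 0 (2 * S i)); intros e He; cbn [sat].
rewrite mix_even; reflexivity.
Qed.

Lemma dterm_const x : M x -> dterm (fun _ => x).
Proof.
intro Hx; split; [auto|]; destruct (proj2 enumeration_spec x Hx) as [n Hn].
exists (Eq 0 (S (2 * n))); intros e He; cbn [sat]; rewrite mix_odd, <- Hn; reflexivity.
Qed.

Lemma def_sub t (P : V -> (nat -> V) -> Prop) :
  dterm t -> definable (fun e => P (e 0) (shift e)) -> definable (fun e => P (t e) e).
Proof.
intros [H1 H2] H; apply (def_ext (def_exM (P := fun x e => x = t e /\ P x e) (def_and H2 H))).
intros e He; split; [intros (x & _ & -> & K); exact K|].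
intro K; exists (t e); auto.
Qed.

Lemma def_rel2 (R : V -> V -> Prop) t u :
  definable (fun e => R (e 0) (e 1)) -> dterm t -> dterm u ->
  definable (fun e => R (t e) (u e)).
Proof.
intros H Ht Hu; apply (def_sub (P := fun x e => R x (u e)) Ht).
apply (def_sub (P := fun y e => R (e 0) y) (dterm_shift Hu)).
exact (def_ren (fun n => match n with O => 1 | _ => 0 end) H).
Qed.

Lemma def_rel3 (R : V -> V -> V -> Prop) t u v :
  definable (fun e => R (e 0) (e 1) (e 2)) -> dterm t -> dterm u -> dterm v ->
  definable (fun e => R (t e) (u e) (v e)).
Proof.
intros H Ht Hu Hv; apply (def_sub (P := fun x e => R x (u e) (v e)) Ht).
apply (def_sub (P := fun y e => R (e 0) y (v (shift e))) (dterm_shift Hu)).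
apply (def_sub (P := fun z e => R (e 1) (e 0) z) (dterm_shift (dterm_shift Hv))).
exact (def_ren (fun n => match n with O => 2 | S O => 1 | _ => 0 end) H).
Qed.

Lemma def_rel1 (R : V -> Prop) t :
  definable (fun e => R (e 0)) -> dterm t -> definable (fun e => R (t e)).
Proof. intros H Ht; apply (def_sub (P := fun x _ => R x) Ht H). Qed.

Lemma def_eq t u : dterm t -> dterm u -> definable (fun e => t e = u e).
Proof.
apply (@def_rel2 (fun x y => x = y)); exact (proj2 (dterm_var 0)).
Qed.

Lemma def_mem t u : dterm t -> dterm u -> definable (fun e => t e ∈ u e).
Proof.
apply (@def_rel2 mem); exists (Mem 0 2); intros e He; reflexivity.
Qed.

Lemma def_bex t (P : V -> (nat -> V) -> Prop) :
  dterm t -> definable (fun e => P (e 0) (shift e)) ->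
  definable (fun e => exists x, x ∈ t e /\ P x e).
Proof.
intros Ht HP; apply def_ex.
- apply def_and; [|exact HP]; apply def_mem; [apply dterm_var|apply dterm_shift, Ht].
- intros e x He [Hx _]; apply M_trans with (2 := Hx), Ht, He.
Qed.

Lemma def_ball t (P : V -> (nat -> V) -> Prop) :
  dterm t -> definable (fun e => P (e 0) (shift e)) ->
  definable (fun e => forall x, x ∈ t e -> P x e).
Proof.
intros Ht HP; apply def_all.
- apply def_imp; [|exact HP]; apply def_mem; [apply dterm_var|apply dterm_shift, Ht].
- intros e x He Hn Hx; destruct Hn; apply M_trans with (2 := Hx), Ht, He.
Qed.

Lemma def_subset t u : dterm t -> dterm u -> definable (fun e => t e ⊆ u e).
Proof.
intros Ht Hu; unfold subset; apply def_ball; [exact Ht|].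
apply def_mem; [apply dterm_var|apply dterm_shift, Hu].
Qed.

Lemma def_true (P : Prop) : definable (fun _ => P).
Proof.
destruct (classic P) as [H|H].
- exists (Eq 0 0); intros e _; simpl; tauto.
- exists (Not (Eq 0 0)); intros e _; simpl; tauto.
Qed.

(** * Separation and replacement for definable predicates *)

Lemma M_sep (P : V -> Prop) x : definable (fun e => P (e 0)) -> M x ->
  exists z, M z /\ forall w, w ∈ z <-> w ∈ x /\ P w.
Proof.
intros [A HA] Hx; destruct M_inhabited as [o Ho].
destruct (zfc_separation (ctm_ZFC hM) A (fun n => mix (fun _ => o) (S n))) with (x := x)
  as (z & Hz & K); auto.
{ intro n; apply inM_mix; intro; exact Ho. }
assert (E : forall w, M w -> (sat M A (scons w (fun n => mix (fun _ => o) (S n))) <-> P w)).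
{ intros w Hw; rewrite <- (HA (scons w (fun _ => o)))
    by (apply inM_scons; [exact Hw|intro; exact Ho]).
  replace (scons w (fun n => mix (fun _ => o) (S n))) with (mix (scons w (fun _ => o)));
    [reflexivity|].
  extensionality n; destruct n as [|[|n]]; reflexivity. }
exists z; split; [exact Hz|]; intro w; split; intro Hw.
- assert (Mw : M w) by exact (M_trans Hz Hw).
  apply K in Hw; [rewrite E in Hw; assumption|exact Mw].
- assert (Mw : M w) by exact (M_trans Hx (proj1 Hw)).
  apply K; [exact Mw|rewrite E; assumption].
Qed.

Lemma M_repl (R : V -> V -> Prop) x :
  definable (fun e => R (e 0) (e 1)) -> M x ->
  (forall u, u ∈ x -> exists v, M v /\ R u v) ->
  (forall u v v', u ∈ x -> R u v -> R u v' -> v = v') ->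
  exists z, M z /\ forall v, v ∈ z <-> exists u, u ∈ x /\ R u v.
Proof.
intros HR Hx Hex Huniq; destruct M_inhabited as [o Ho].
destruct (def_ren (fun n => match n with O => 1 | _ => 0 end) HR) as [A HA]; simpl in HA.
(* The axiom places value and argument in front of the mixture, whereas [A] reads them at indices 0
   and 2 of a mixed environment. *)
set (B := ren (fun n => match n with O => O | S O => 3 | 2 => 1 | n => S (S n) end) A).
assert (E : forall u v, M u -> M v ->
  (sat M B (scons v (scons u (fun n => mix (fun _ => o) n))) <-> R u v)).
{ intros u v Hu Hv.
  rewrite <- (HA (scons v (scons u (fun _ => o))))
    by (repeat apply inM_scons; auto; intro; exact Ho).
  unfold B; rewrite sat_ren.
  match goal with |- sat M A ?a <-> sat M A ?b => replace a with b; [reflexivity|] end.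
  extensionality n; destruct n as [|[|[|[|n]]]]; reflexivity. }
destruct (zfc_replacement (ctm_ZFC hM) B (fun n => mix (fun _ => o) n)) with (x := x)
  as (z & Hz & K); auto.
{ intro n; apply inM_mix; intro; exact Ho. }
{ intros u Hu Hux; destruct (Hex u Hux) as (v & Hv & Ruv); exists v; split.
  - rewrite E; auto.
  - intros v' [Hv' Rv']; rewrite E in Rv'; eauto. }
(* The axiom yields only a set that includes the image; separation cuts it down to the image
   itself. *)
destruct (M_sep (P := fun v => exists u, u ∈ x /\ R u v)) with (x := z) as (y & Hy & L); auto.
{ apply def_bex; [apply dterm_const, Hx|].
  exact (def_rel2 HR (dterm_var 0) (dterm_var 1)). }
exists y; split; [exact Hy|]; intro v; rewrite L; split; [tauto|].
intro Hv; split; [|exact Hv]; destruct Hv as (u & Hu & Ruv).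
destruct (K u) as (v' & Mv' & Hv' & S'); eauto using M_trans.
rewrite E in S'; eauto using M_trans.
rewrite (Huniq u v v'); auto.
Qed.

(** Bounded and relativised quantifiers are tried before [def_ex] and [def_all], so that
    absoluteness goals arise only for quantifiers that are really unrestricted. *)
Ltac dstep :=
  cbv beta delta [shift];
  first
  [ apply dterm_var
  | apply dterm_const; solve [eauto]
  | apply def_true
  | apply def_mem | apply def_eq | apply def_subset
  | apply def_and | apply def_or | apply def_not
  | apply def_bex | apply def_ball | apply def_exM | apply def_allM
  | apply def_ex | apply def_imp | apply def_all ].

Ltac destr :=
  repeat match goal with
  | H : exists _, _ |- _ => destruct H
  | H : _ /\ _ |- _ => destruct H
  end.

Lemma dterm_fun1 (F : V -> V) t :
  (forall x, M x -> M (F x)) -> definable (fun e => e 0 = F (e 1)) ->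
  dterm t -> dterm (fun e => F (t e)).
Proof.
intros H1 H2 Ht; split; [intros e He; apply H1, Ht, He|].
exact (def_rel2 (R := fun x y => x = F y) H2 (dterm_var 0) (dterm_shift Ht)).
Qed.

Lemma dterm_fun2 (F : V -> V -> V) t u :
  (forall x y, M x -> M y -> M (F x y)) -> definable (fun e => e 0 = F (e 1) (e 2)) ->
  dterm t -> dterm u -> dterm (fun e => F (t e) (u e)).
Proof.
intros H1 H2 Ht Hu; split; [intros e He; apply H1; [apply Ht, He|apply Hu, He]|].
exact (def_rel3 (R := fun x y z => x = F y z) H2 (dterm_var 0)
  (dterm_shift Ht) (dterm_shift Hu)).
Qed.

(** * Sets in the model *)

Lemma M_upair x y : M x -> M y -> M (upair x y).
Proof.
intros Hx Hy; destruct (zfc_pairing (ctm_ZFC hM) _ _ Hx Hy) as (z & Hz & K).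
replace (upair x y) with z; [exact Hz|].
apply set_ext; intro w; rewrite in_upair; split; intro Hw.
- apply K; [exact (M_trans Hz Hw)|exact Hw].
- apply K; [destruct Hw as [->| ->]; assumption|exact Hw].
Qed.

Lemma upair_eq x y z : z = upair x y <-> x ∈ z /\ y ∈ z /\ forall w, w ∈ z -> w = x \/ w = y.
Proof.
split.
- intros ->; repeat split; [apply in_upair; auto|apply in_upair; auto|].
  intros w Hw; apply in_upair, Hw.
- intros (H1 & H2 & H3); apply set_ext; intro w; rewrite in_upair; split; [apply H3|].
  intros [->| ->]; assumption.
Qed.

Lemma dterm_upair t u : dterm t -> dterm u -> dterm (fun e => upair (t e) (u e)).
Proof.
apply dterm_fun2; [exact M_upair|].
eapply def_ext; [|intros e _; symmetry; apply upair_eq]; repeat dstep.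
Qed.

Lemma M_pair x y : M x -> M y -> M ⟨x, y⟩.
Proof. intros; repeat apply M_upair; assumption. Qed.

Lemma dterm_pair t u : dterm t -> dterm u -> dterm (fun e => ⟨t e, u e⟩).
Proof. intros; repeat apply dterm_upair; assumption. Qed.

Lemma M_pair_inv x y : M ⟨x, y⟩ -> M x /\ M y.
Proof.
intro H; assert (K : M (upair x y)) by (apply M_trans with (1 := H), in_upair; auto).
split; apply M_trans with (1 := K), in_upair; auto.
Qed.

Lemma M_fst x y : M ⟨x, y⟩ -> M x.
Proof. apply M_pair_inv. Qed.

Lemma M_snd x y : M ⟨x, y⟩ -> M y.
Proof. apply M_pair_inv. Qed.

Lemma M_empty : M empty.
Proof.
destruct M_inhabited as [o Ho].
destruct (@M_sep (fun _ => False) o) as (z & Hz & K); [apply def_true|exact Ho|].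
replace empty with z; [exact Hz|].
apply set_ext; intro w; rewrite K; split; [tauto|intro H; destruct (in_empty _ H)].
Qed.

Lemma M_union x : M x -> exists z, M z /\ forall w, w ∈ z <-> exists y, y ∈ x /\ w ∈ y.
Proof.
intro Hx; destruct (zfc_union (ctm_ZFC hM) _ Hx) as (z & Hz & K); exists z.
split; [exact Hz|]; intro w; split; intro Hw.
- apply K in Hw; [destr; eauto|exact (M_trans Hz Hw)].
- destruct Hw as (y & Hy & Hw); apply K; eauto using M_trans.
Qed.

Lemma M_power x : M x -> exists z, M z /\ forall w, w ∈ z <-> M w /\ w ⊆ x.
Proof.
intro Hx; destruct (zfc_power (ctm_ZFC hM) _ Hx) as (z & Hz & K); exists z.
split; [exact Hz|]; intro w; split.
- intro Hw; assert (Mw := M_trans Hz Hw); split; [exact Mw|].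
  intros u Hu; apply (proj1 (K w Mw) Hw); eauto using M_trans.
- intros [Mw Hw]; apply K; auto.
Qed.

Lemma in_cup x y z : z ∈ {{ w | w ∈ x \/ w ∈ y }} <-> z ∈ x \/ z ∈ y.
Proof.
apply (@in_compr (fun w => w ∈ x \/ w ∈ y)).
destruct (small_mem x) as (A & f & Hf), (small_mem y) as (B & g & Hg).
exists (A + B)%type, (fun s => match s with inl a => f a | inr b => g b end).
intros w [Hw|Hw].
- destruct (Hf w Hw) as [a ->]; exists (inl a); reflexivity.
- destruct (Hg w Hw) as [b ->]; exists (inr b); reflexivity.
Qed.

Definition cup (x y : V) : V := {{ w | w ∈ x \/ w ∈ y }}.

Lemma M_cup x y : M x -> M y -> M (cup x y).
Proof.
intros Hx Hy; destruct (M_union (M_upair Hx Hy)) as (z & Hz & K).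
replace (cup x y) with z; [exact Hz|]; apply set_ext; intro w; unfold cup.
rewrite in_cup, K; split.
- intros (u & Hu & Hw); apply in_upair in Hu; destruct Hu as [->| ->]; auto.
- intros [Hw|Hw]; [exists x|exists y]; (split; [apply in_upair; auto|exact Hw]).
Qed.

Lemma num_S n : num (S n) = cup (num n) (upair (num n) (num n)).
Proof.
apply set_ext; intro z; unfold cup; rewrite in_num_S, in_cup, in_upair; tauto.
Qed.

Lemma M_num n : M (num n).
Proof.
induction n as [|n IH]; [exact M_empty|rewrite num_S; auto using M_cup, M_upair].
Qed.

(** The axiom of infinity may give too large a set. The intersection of all inductive sets of [M] is
    definable, and it contains only true numbers because membership is well-founded in the ambient
    universe. *)
Lemma M_omega : M omega.
Proof.
destruct (zfc_infinity (ctm_ZFC hM)) as (x & Hx & (o & Ho & Hox & Eo) & Hsuc).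
set (inductive := fun y => (exists o, o ∈ y /\ forall u, ~ u ∈ o) /\
  forall u, u ∈ y -> exists s, s ∈ y /\ u ∈ s /\ u ⊆ s /\ forall v, v ∈ s -> v ∈ u \/ v = u).
assert (Dind : definable (fun e => inductive (e 0))) by (unfold inductive; repeat dstep).
assert (Ind : forall y, inductive y -> forall n, num n ∈ y).
{ intros y [(o' & Ho' & Eo') Hs] n; induction n as [|n IH].
  - replace (num 0) with o'; [exact Ho'|].
    apply set_ext; intro z; split; intro Hz; [destruct (Eo' _ Hz)|destruct (in_empty _ Hz)].
  - destruct (Hs _ IH) as (s & Hsy & H1 & H2 & H3); replace (num (S n)) with s; [exact Hsy|].
    apply set_ext; intro z; rewrite in_num_S; split; [apply H3|].
    intros [Hz| ->]; auto. }
assert (Hxi : inductive x).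
{ split; [exists o; split; [exact Hox|]; intros u Hu; exact (Eo u (M_trans Ho Hu) Hu)|].
  intros u Hu; destruct (Hsuc u (M_trans Hx Hu) Hu) as (s & Ms & Hs & K); exists s.
  split; [exact Hs|]; split; [apply K; [exact (M_trans Hx Hu)|auto]|]; split.
  - intros v Hv; apply K; [exact (M_trans (M_trans Hx Hu) Hv)|auto].
  - intros v Hv; apply K; [exact (M_trans Ms Hv)|exact Hv]. }
destruct (M_sep (P := fun z => forall y, M y -> inductive y -> z ∈ y)) with (x := x)
  as (w & Hw & K); [|exact Hx|].
{ repeat first [apply (def_rel1 Dind)|dstep]. }
assert (Kw : forall z, z ∈ w <-> forall y, M y -> inductive y -> z ∈ y)
  by (intro z; rewrite K; split; [tauto|auto]).
assert (L : forall z, z ∈ w -> z ∈ omega).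
{ intro z; induction (mem_wf z) as [z _ IH]; intro Hz; apply NNPP; intro Hn.
  (* A minimal non-number could be dropped from the least inductive set *)
  destruct (@M_sep (fun v => v <> z) w) as (w' & Hw' & K'); auto.
  { assert (M z) by exact (M_trans Hw Hz); repeat dstep. }
  assert (Hi : inductive w').
  { split.
    - exists (num 0); split; [|exact in_empty]; apply K'; split.
      + apply Kw; auto.
      + intros <-; apply Hn, in_omega; exists 0; reflexivity.
    - intros u Hu; apply K' in Hu; destruct Hu as [Hu Huz].
      exists (cup u (upair u u)).
      assert (C : forall v, v ∈ cup u (upair u u) <-> v ∈ u \/ v = u)
        by (intro v; unfold cup; rewrite in_cup, in_upair; tauto).
      split; [|split; [apply C; auto|split; [intros v Hv; apply C; auto|apply C]]].
      apply K'; split.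
      + apply Kw; intros y My Hy; destruct (proj2 Hy u (proj1 (Kw u) Hu y My Hy))
          as (s & Hs & H1 & H2 & H3).
        replace (cup u (upair u u)) with s; [exact Hs|].
        apply set_ext; intro v; rewrite C; split; [apply H3|intros [Hv| ->]; auto].
      + intro E; apply Hn.
        assert (Huz' : u ∈ z) by (rewrite <- E; apply C; auto).
        apply in_omega; destruct (proj1 (in_omega u) (IH u Huz' Hu)) as [n Hun]; exists (S n).
        rewrite num_S, <- Hun; symmetry; exact E. }
  exact (proj2 (proj1 (K' z) (proj1 (Kw z) Hz w' Hw' Hi)) eq_refl). }
replace omega with w; [exact Hw|].
apply set_ext; intro z; split; [apply L|]; intro Hz; apply in_omega in Hz.
destruct Hz as [n ->]; apply Kw; auto.
Qed.

Lemma M_image (F : V -> V) x :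
  (forall y, M y -> M (F y)) -> definable (fun e => e 0 = F (e 1)) -> M x ->
  exists z, M z /\ forall w, w ∈ z <-> exists y, y ∈ x /\ w = F y.
Proof.
intros HF DF Hx; apply (M_repl (R := fun y w => w = F y)).
- exact (def_ren (fun n => match n with O => 1 | _ => 0 end) DF).
- exact Hx.
- intros u Hu; exists (F u); eauto using M_trans.
- congruence.
Qed.

Lemma M_prod x y : M x -> M y -> M (prod x y).
Proof.
intros Hx Hy.
(* The slice of the product over [a] is described by its members, so that it is definable; the
   product is the union of the slices. *)
destruct (M_repl (R := fun a z => (forall b, b ∈ y -> ⟨a, b⟩ ∈ z) /\
    forall w, w ∈ z -> exists b, b ∈ y /\ w = ⟨a, b⟩)) with (x := x) as (z & Hz & K).
- repeat first [apply dterm_pair|dstep].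
- exact Hx.
- intros a Ha; assert (Ma := M_trans Hx Ha).
  destruct (M_image (F := fun b => ⟨a, b⟩)) with (x := y) as (z & Hz & K).
  + intros; apply M_pair; assumption.
  + repeat first [apply dterm_pair|dstep].
  + exact Hy.
  + exists z; split; [exact Hz|]; split; intros; apply K; eauto.
- intros a z z' Ha [H1 H2] [H3 H4]; apply subset_antisym.
  + intros w Hw; destruct (H2 w Hw) as (b & Hb & ->); auto.
  + intros w Hw; destruct (H4 w Hw) as (b & Hb & ->); auto.
- destruct (M_union Hz) as (u & Hu & L); replace (prod x y) with u; [exact Hu|].
  apply set_ext; intro w; rewrite L, in_prod; split.
  + intros (v & Hv & Hw); apply K in Hv; destruct Hv as (a & Ha & _ & H2).
    destruct (H2 w Hw) as (b & Hb & ->); eauto.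
  + intros (a & b & Ha & Hb & ->).
    destruct (M_image (F := fun b => ⟨a, b⟩)) with (x := y) as (v & Hv & Kv).
    * intros; apply M_pair; eauto using M_trans.
    * assert (M a) by eauto using M_trans; repeat first [apply dterm_pair|dstep].
    * exact Hy.
    * exists v; split; [|apply Kv; eauto].
      apply K; exists a; split; [exact Ha|]; split; intros; apply Kv; eauto.
Qed.

Lemma M_image2 (F : V -> V -> V) x y :
  (forall a b, M a -> M b -> M (F a b)) -> definable (fun e => e 0 = F (e 1) (e 2)) ->
  M x -> M y ->
  exists z, M z /\ forall w, w ∈ z <-> exists a b, a ∈ x /\ b ∈ y /\ w = F a b.
Proof.
intros HF DF Hx Hy.
destruct (M_repl (R := fun u w => exists a b, u = ⟨a, b⟩ /\ w = F a b)) with (x := prod x y)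
  as (z & Hz & K).
- dstep; [dstep; [dstep|]|].
  + repeat first [apply dterm_pair|dstep].
  + exact (def_rel3 (R := fun x y z => x = F y z) DF (dterm_var 3) (dterm_var 1) (dterm_var 0)).
  + intros e b He (E & _); assert (K := He 1); cbn in K, E; rewrite E in K.
    exact (M_snd K).
  + intros e a He (b & E & _); assert (K := He 0); rewrite E in K; exact (M_fst K).
- apply M_prod; assumption.
- intros u Hu; apply in_prod in Hu; destruct Hu as (a & b & Ha & Hb & ->).
  exists (F a b); split; [|exists a, b; auto]; apply HF; eauto using M_trans.
- intros u v v' _ (a & b & -> & ->) (a' & b' & E & ->).
  apply pair_inj in E; destruct E as [-> ->]; reflexivity.
- exists z; split; [exact Hz|]; intro w; rewrite K; split.
  + intros (u & Hu & a & b & -> & ->); apply in_prod in Hu.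
    destruct Hu as (a' & b' & Ha & Hb & E); apply pair_inj in E; destruct E as [-> ->].
    exists a', b'; auto.
  + intros (a & b & Ha & Hb & ->); exists ⟨a, b⟩; split; [apply in_prod|]; eauto 6.
Qed.

(** * Check names and transitive closures *)

(** [empty] is the weakest condition of both posets, so [chk x] is a check name of [x] for
    either of them. *)
Definition chk : V -> V :=
  Fix mem_wf (fun _ => V) (fun x rec => {{ z | exists y (h : y ∈ x), z = ⟨empty, rec y h⟩ }}).

Lemma in_chk x z : z ∈ chk x <-> exists y, y ∈ x /\ z = ⟨empty, chk y⟩.
Proof.
unfold chk at 1; rewrite Fix_eq; fold chk.
2:{ intros u f g H; f_equal; extensionality w; apply propositional_extensionality.
    split; intros (y & h & ->); exists y, h; rewrite H; reflexivity. }
rewrite in_compr.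
- split; [intros (y & h & E); exists y; auto|intros (y & h & E); exists y, h; exact E].
- apply small_sub with (Q := fun w => exists y, y ∈ x /\ w = ⟨empty, chk y⟩).
  + intros w (y & h & ->); exists y; auto.
  + apply small_repl; [apply small_mem|congruence].
Qed.

(** [chk_graph f] says that [f] is the restriction of [chk] to a transitive set. *)
Definition chk_graph (f : V) : Prop :=
  forall w, w ∈ f -> exists a b, w = ⟨a, b⟩ /\
    (forall x, x ∈ a -> exists y, ⟨x, y⟩ ∈ f /\ ⟨empty, y⟩ ∈ b) /\
    (forall z, z ∈ b -> exists x y, x ∈ a /\ ⟨x, y⟩ ∈ f /\ z = ⟨empty, y⟩).

Lemma chk_graph_val f : chk_graph f -> forall a b, ⟨a, b⟩ ∈ f -> b = chk a.
Proof.
intros Hf a; induction (mem_wf a) as [a _ IH]; intros b Hab.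
destruct (Hf _ Hab) as (a' & b' & E & H1 & H2).
apply pair_inj in E; destruct E as [<- <-].
apply set_ext; intro z; rewrite in_chk; split.
- intro Hz; destruct (H2 z Hz) as (x & y & Hx & Hy & ->); exists x; split; [exact Hx|].
  rewrite (IH x Hx y Hy); reflexivity.
- intros (x & Hx & ->); destruct (H1 x Hx) as (y & Hy & K).
  rewrite <- (IH x Hx y Hy); exact K.
Qed.

Lemma chk_graph_dom f : chk_graph f -> forall a x, ⟨a, chk a⟩ ∈ f -> x ∈ a -> ⟨x, chk x⟩ ∈ f.
Proof.
intros Hf a x Ha Hx; destruct (Hf _ Ha) as (a' & b' & E & H1 & _).
apply pair_inj in E; destruct E as [<- _]; destruct (H1 x Hx) as (y & Hy & _).
rewrite <- (chk_graph_val Hf Hy); exact Hy.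
Qed.

(** Closes absoluteness goals: the object in question is usually a component of a pair that lies in
    [M]. Seven entries of the environment are instantiated, enough for the nesting of quantifiers
    that occurs. *)
Ltac mside :=
  intros; destr; subst;
  repeat match goal with He : inM ?e |- _ =>
    pose proof (He 0); pose proof (He 1); pose proof (He 2); pose proof (He 3);
    pose proof (He 4); pose proof (He 5); pose proof (He 6); clear He end;
  repeat match goal with
  | K : ?e ?n = _, H : M (?e ?n) |- _ => rewrite K in H
  end;
  try match goal with H : ~ M _ |- _ => exfalso; apply H end;
  eauto using M_fst, M_snd, M_trans.

Ltac dsolve :=
  repeat first [progress (cbv beta delta [shift]; apply dterm_pair)|dstep]; mside.

Lemma def_chk_graph : definable (fun e => chk_graph (e 0)).
Proof.
assert (M empty) by exact M_empty.
unfold chk_graph; dsolve.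
Qed.

Definition least_chk_graph (x f : V) : Prop :=
  chk_graph f /\ (exists b, ⟨x, b⟩ ∈ f) /\
  forall f', M f' -> chk_graph f' -> (exists b, ⟨x, b⟩ ∈ f') -> f ⊆ f'.

Lemma def_least_chk_graph : definable (fun e => M (e 1) /\ least_chk_graph (e 0) (e 1)).
Proof.
assert (D := def_chk_graph); unfold least_chk_graph.
apply def_and; [exists (Eq 0 0); intros e He; simpl; split; auto|].
repeat first [apply dterm_pair|apply (def_rel1 D)|dstep]; mside.
Qed.

(** Replacement needs a canonical witness, hence the least graph. *)
Lemma least_chk_graph_ex x : M x -> M (chk x) /\ exists f, M f /\ least_chk_graph x f.
Proof.
(* The induction runs in the metatheory and stands in for a recursion theorem inside [M]. *)
induction (mem_wf x) as [x _ IH]; intro Hx.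
destruct (M_repl (R := fun y f => M f /\ least_chk_graph y f) def_least_chk_graph Hx)
  as (Z & HZ & KZ).
{ intros u Hu; destruct (proj2 (IH u Hu (M_trans Hx Hu))) as (f & Hf & L); eauto. }
{ intros u f f' Hu (Mf & H1 & H2 & H3) (Mf' & K1 & K2 & K3).
  apply subset_antisym; auto. }
destruct (M_union HZ) as (U & HU & KU).
assert (GU : chk_graph U).
{ intros w Hw; apply KU in Hw; destruct Hw as (f & Hf & Hw).
  destruct (proj1 (KZ f) Hf) as (u & _ & _ & G & _).
  destruct (G w Hw) as (a & b & -> & H1 & H2); exists a, b; split; [reflexivity|]; split.
  - intros y Hy; destruct (H1 y Hy) as (d & Hd & K); exists d; split; [|exact K].
    apply KU; eauto.
  - intros z Hz; destruct (H2 z Hz) as (y & d & Hy & Hd & K); exists y, d.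
    repeat split; try assumption; apply KU; eauto. }
assert (dU : forall y, y ∈ x -> ⟨y, chk y⟩ ∈ U).
{ intros y Hy; destruct (proj2 (IH y Hy (M_trans Hx Hy))) as (f & Hf & L).
  destruct (proj1 (proj2 L)) as [b Hb]; rewrite <- (chk_graph_val (proj1 L) Hb).
  apply KU; exists f; split; [apply KZ; eauto|exact Hb]. }
assert (Mx : M (chk x)).
{ destruct (M_repl (R := fun y z => exists d, ⟨y, d⟩ ∈ U /\ z = ⟨empty, d⟩)) with (x := x)
    as (C & HC & KC).
  - assert (M empty) by exact M_empty; dsolve.
  - exact Hx.
  - intros y Hy; exists ⟨empty, chk y⟩; split; [|exists (chk y); auto].
    apply M_pair; [exact M_empty|apply (IH y Hy), (M_trans Hx Hy)].
  - intros y z z' _ (d & Hd & ->) (d' & Hd' & ->).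
    rewrite (chk_graph_val GU Hd), (chk_graph_val GU Hd'); reflexivity.
  - replace (chk x) with C; [exact HC|].
    apply set_ext; intro z; rewrite KC, in_chk; split.
    + intros (y & Hy & d & Hd & ->); exists y; split; [exact Hy|].
      rewrite (chk_graph_val GU Hd); reflexivity.
    + intros (y & Hy & ->); exists y; split; [exact Hy|]; exists (chk y); auto. }
split; [exact Mx|].
(* The graphs for the elements of [x] are glued into [U], and one pair for [x] itself is put on top;
   minimality of each piece gives minimality of [f]. *)
set (f := cup U (upair ⟨x, chk x⟩ ⟨x, chk x⟩)).
assert (Kf : forall w, w ∈ f <-> w ∈ U \/ w = ⟨x, chk x⟩)
  by (intro w; unfold f, cup; rewrite in_cup, in_upair; tauto).
exists f; split; [apply M_cup; auto using M_upair, M_pair|]; split; [|split].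
- intros w Hw; apply Kf in Hw; destruct Hw as [Hw| ->].
  + destruct (GU w Hw) as (a & b & -> & H1 & H2); exists a, b; split; [reflexivity|]; split.
    * intros y Hy; destruct (H1 y Hy) as (d & Hd & K); exists d; split; [|exact K].
      apply Kf; auto.
    * intros z Hz; destruct (H2 z Hz) as (y & d & Hy & Hd & K); exists y, d.
      repeat split; try assumption; apply Kf; auto.
  + exists x, (chk x); split; [reflexivity|]; split.
    * intros y Hy; exists (chk y); split; [apply Kf; auto|apply in_chk; eauto].
    * intros z Hz; apply in_chk in Hz; destruct Hz as (y & Hy & ->); exists y, (chk y).
      repeat split; try assumption; apply Kf; auto.
- exists (chk x); apply Kf; auto.
- intros f' Mf' Hf' (b & Hb); rewrite (chk_graph_val Hf' Hb) in Hb.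
  intros w Hw; apply Kf in Hw; destruct Hw as [Hw| ->]; [|exact Hb].
  apply KU in Hw; destruct Hw as (g & Hg & Hw); apply KZ in Hg.
  destruct Hg as (y & Hy & Mg & _ & _ & Lg).
  apply (Lg f'); auto; exists (chk y); exact (chk_graph_dom Hf' Hb Hy).
Qed.

Lemma M_chk x : M x -> M (chk x).
Proof. apply least_chk_graph_ex. Qed.

Lemma dterm_chk t : dterm t -> dterm (fun e => chk (t e)).
Proof.
apply dterm_fun1; [exact M_chk|].
apply (@def_ext (fun e => exists f, M f /\ chk_graph f /\ ⟨e 1, e 0⟩ ∈ f)).
- assert (D := def_chk_graph).
  repeat first [apply dterm_pair|apply (def_rel1 D)|dstep].
- intros e He; split.
  + intros (f & _ & Hf & K); exact (chk_graph_val Hf K).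
  + intros ->; destruct (proj2 (least_chk_graph_ex (He 1))) as (f & Mf & Hf & (b & Hb) & _).
    exists f; rewrite (chk_graph_val Hf Hb) in Hb; auto.
Qed.

Definition transitive (x : V) : Prop := forall y, y ∈ x -> y ⊆ x.

(** The domain of a graph of [chk] is transitive, so the graph found for [x] already supplies such a
    set. It is not claimed to be the least one. *)
Lemma M_transitive_closure x : M x -> exists t, M t /\ transitive t /\ x ∈ t.
Proof.
intro Hx; destruct (proj2 (least_chk_graph_ex Hx)) as (f & Mf & Hf & (b & Hb) & _).
destruct (M_repl (R := fun w y => exists d, w = ⟨y, d⟩)) with (x := f) as (t & Mt & Kt).
- dsolve.
- exact Mf.
- intros w Hw; destruct (Hf w Hw) as (a & d & -> & _); exists a; split; [|eauto].
  exact (M_fst (M_trans Mf Hw)).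
- intros w y y' _ (d & ->) (d' & E); apply pair_inj in E; tauto.
- exists t; split; [exact Mt|]; split; [|apply Kt; eauto].
  intros y Hy z Hz; apply Kt in Hy; destruct Hy as (w & Hw & d & ->).
  rewrite (chk_graph_val Hf Hw) in Hw.
  apply Kt; exists ⟨z, chk z⟩; split; [exact (chk_graph_dom Hf Hw Hz)|eauto].
Qed.

(** * Finite sets *)

(** An injection into a natural number, which is what finiteness means inside [M]. *)
Definition counts (f p n : V) : Prop :=
  (forall x, x ∈ p -> exists k, k ∈ n /\ ⟨x, k⟩ ∈ f) /\
  (forall w, w ∈ f -> exists x k, k ∈ n /\ w = ⟨x, k⟩) /\
  (forall x y k, ⟨x, k⟩ ∈ f -> ⟨y, k⟩ ∈ f -> x = y).

Lemma in_num n x : x ∈ num n <-> exists k, k < n /\ x = num k.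
Proof.
induction n as [|n IH].
- split; [intro H; destruct (in_empty _ H)|intros (k & Hk & _); lia].
- rewrite in_num_S, IH; split.
  + intros [(k & Hk & ->)| ->]; [exists k|exists n]; split; auto; lia.
  + intros (k & Hk & ->); destruct (Nat.eq_dec k n) as [->|E]; [auto|].
    left; exists k; split; [lia|reflexivity].
Qed.

Lemma counts_finite f p n : counts f p (num n) -> finite p.
Proof.
intros (H1 & _ & H3).
exists (map (fun k => epsilon (inhabits empty) (fun x => ⟨x, num k⟩ ∈ f)) (seq 0 n)).
intros x Hx; destruct (H1 x Hx) as (k & Hk & K); apply in_num in Hk.
destruct Hk as (m & Hm & ->); apply in_map_iff; exists m; split; [|apply in_seq; lia].
apply H3 with (2 := K), epsilon_spec; exists x; exact K.
Qed.

(** Induction on the list, removing its head from [p]. As [M] is closed under adjoining one element,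
    [p] and its counting function return to [M] together; this makes finiteness absolute. *)
Lemma finite_counts l : forall p, (forall x, x ∈ p -> In x l /\ M x) ->
  M p /\ exists n f, M f /\ counts f p (num n).
Proof.
induction l as [|a l IH]; intros p Hp.
- replace p with empty.
  + split; [exact M_empty|]; exists 0, empty; split; [exact M_empty|].
    repeat split; intros; exfalso; eapply in_empty; eassumption.
  + apply set_ext; intro z; split; intro Hz; [destruct (in_empty _ Hz)|].
    destruct (proj1 (Hp z Hz)).
- destruct (classic (a ∈ p)) as [Ha|Ha].
  2:{ apply IH; intros x Hx; destruct (Hp x Hx) as [[<-|K] Mx]; [contradiction|auto]. }
  set (q := {{ x | x ∈ p /\ x <> a }}).
  assert (Kq : forall x, x ∈ q <-> x ∈ p /\ x <> a).
  { apply in_compr; apply small_sub with (2 := small_mem p); tauto. }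
  destruct (IH q) as (Mq & n & f & Mf & H1 & H2 & H3).
  { intros x Hx; apply Kq in Hx; destruct Hx as [Hx E].
    destruct (Hp x Hx) as [[K|K] Mx]; [congruence|auto]. }
  assert (Ma := proj2 (Hp a Ha)).
  assert (Ep : forall x, x ∈ p <-> x ∈ q \/ x = a).
  { intro x; rewrite Kq; split; [intro; destruct (classic (x = a)); tauto|].
    intros [K| ->]; tauto. }
  split.
  + replace p with (cup q (upair a a)); [auto using M_cup, M_upair|].
    apply set_ext; intro x; unfold cup; rewrite in_cup, in_upair, Ep; tauto.
  + exists (S n), (cup f (upair ⟨a, num n⟩ ⟨a, num n⟩)).
    split; [auto using M_cup, M_upair, M_pair, M_num|].
    assert (Kf : forall w, w ∈ cup f (upair ⟨a, num n⟩ ⟨a, num n⟩) <->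
      w ∈ f \/ w = ⟨a, num n⟩) by (intro w; unfold cup; rewrite in_cup, in_upair; tauto).
    assert (N : forall x, ~ ⟨x, num n⟩ ∈ f).
    { intros x K; destruct (H2 _ K) as (y & k & Hk & E); apply pair_inj in E.
      destruct E as [_ <-]; apply in_num in Hk; destruct Hk as (m & Hm & E).
      apply num_inj in E; lia. }
    split; [|split].
    * intros x Hx; apply Ep in Hx; destruct Hx as [Hx| ->].
      -- destruct (H1 x Hx) as (k & Hk & K); exists k; split; [apply in_num_S; auto|].
         apply Kf; auto.
      -- exists (num n); split; [apply in_num_S|apply Kf]; auto.
    * intros w Hw; apply Kf in Hw; destruct Hw as [Hw| ->].
      -- destruct (H2 w Hw) as (x & k & Hk & ->); exists x, k; split; [|reflexivity].
         apply in_num_S; auto.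
      -- exists a, (num n); split; [apply in_num_S; auto|reflexivity].
    * intros x y k Hx Hy; apply Kf in Hx; apply Kf in Hy.
      destruct Hx as [Hx|Hx], Hy as [Hy|Hy].
      -- eauto.
      -- apply pair_inj in Hy; destruct Hy as [-> ->]; destruct (N _ Hx).
      -- apply pair_inj in Hx; destruct Hx as [-> ->]; destruct (N _ Hy).
      -- apply pair_inj in Hx; apply pair_inj in Hy; destruct Hx, Hy; congruence.
Qed.

Lemma M_finite_subsets x : M x ->
  exists z, M z /\ forall p, p ∈ z <-> finite p /\ p ⊆ x.
Proof.
intro Hx; destruct (M_power Hx) as (B & HB & KB).
destruct (M_sep (P := fun p => exists n, n ∈ omega /\ exists f, M f /\ counts f p n))
  with (x := B) as (z & Hz & Kz).
- assert (M omega) by exact M_omega; unfold counts; dsolve.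
- exact HB.
- exists z; split; [exact Hz|]; intro p; rewrite Kz, KB; split.
  + intros ((_ & Hp) & n & Hn & f & _ & K); split; [|exact Hp].
    apply in_omega in Hn; destruct Hn as [m ->]; exact (counts_finite K).
  + intros ([l Hl] & Hp); destruct (@finite_counts l p) as (Mp & n & f & Mf & K).
    * intros y Hy; split; [auto|exact (M_trans Hx (Hp y Hy))].
    * split; [auto|]; exists (num n); split; [apply in_omega; eauto|eauto].
Qed.

Lemma M_Fn I J : M I -> M J -> M (Fn I J).
Proof.
intros HI HJ; destruct (M_finite_subsets (M_prod HI HJ)) as (F & HF & KF).
destruct (M_sep (P := single_valued)) with (x := F) as (z & Hz & Kz).
- unfold single_valued; dsolve.
- exact HF.
- replace (Fn I J) with z; [exact Hz|].
  apply set_ext; intro p; rewrite Kz, KF, in_Fn; tauto.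
Qed.

Lemma M_Inj I J : M I -> M J -> M (Inj I J).
Proof.
intros HI HJ; destruct (M_finite_subsets (M_prod HI HJ)) as (F & HF & KF).
destruct (M_sep (P := fun p => single_valued p /\ one_to_one p)) with (x := F)
  as (z & Hz & Kz).
- unfold single_valued, one_to_one; dsolve.
- exact HF.
- replace (Inj I J) with z; [exact Hz|].
  apply set_ext; intro p; rewrite Kz, KF, in_Inj; tauto.
Qed.

(** * Generic filters and forced equality *)

Record M_notion (Q : notion) : Prop := {
  M_cond : M (cond Q);
  def_le : definable (fun e => le Q (e 0) (e 1));
  le_refl : forall p, p ∈ cond Q -> le Q p p;
  le_trans : forall p q r, le Q p q -> le Q q r -> le Q p r
}.

Section Generic.

Variable Q : notion.
Variable hQ : M_notion Q.
Variable G : V.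
Variable hG : generic M Q G.

Lemma generic_cond p : p ∈ G -> p ∈ cond Q.
Proof. apply (proj1 hG). Qed.

Lemma generic_up p q : p ∈ G -> q ∈ cond Q -> le Q p q -> q ∈ G.
Proof. apply (proj1 hG). Qed.

Lemma generic_common p q : p ∈ G -> q ∈ G -> exists r, r ∈ G /\ le Q r p /\ le Q r q.
Proof. apply (proj1 hG). Qed.

(** The conditions that satisfy [P] or have no extension satisfying it form a dense set, which
    separation puts into [M]. *)
Lemma generic_decides (P : V -> Prop) : definable (fun e => P (e 0)) ->
  exists p, p ∈ G /\ (P p \/ forall q, q ∈ cond Q -> le Q q p -> ~ P q).
Proof.
intro DP; assert (MC := M_cond hQ); assert (Dle := def_le hQ).
destruct (M_sep (P := fun p => P p \/ forall q, q ∈ cond Q -> le Q q p -> ~ P q))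
  with (x := cond Q) as (D & MD & KD).
- repeat first [apply (def_rel1 DP)|apply (def_rel2 Dle)|dstep].
- exact MC.
- destruct (proj2 hG D MD) as (p & Hp & Gp); [|exists p; split; [|apply KD]; assumption].
  split; [intros p Hp; apply KD, Hp|].
  intros p Hp; destruct (classic (exists q, q ∈ cond Q /\ le Q q p /\ P q))
    as [(q & Hq & L & K)|N].
  + exists q; split; [apply KD|]; auto.
  + exists p; split; [|exact (le_refl hQ Hp)]; apply KD; split; [exact Hp|].
    right; intros q Hq L K; apply N; eauto.
Qed.

(** A condition of [G] excluding [P] would have a common extension with [p0], against density below
    [p0]. *)
Lemma generic_below (P : V -> Prop) p0 : definable (fun e => P (e 0)) -> p0 ∈ G ->
  (forall p, p ∈ cond Q -> le Q p p0 -> exists q, q ∈ cond Q /\ le Q q p /\ P q) ->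
  exists p, p ∈ G /\ P p.
Proof.
intros DP G0 H; destruct (generic_decides DP) as (p & Gp & [K|K]); [eauto|].
destruct (generic_common Gp G0) as (r & Gr & L1 & L2).
destruct (H r (generic_cond Gr) L2) as (q & Hq & L & Pq).
destruct (K q Hq (le_trans hQ L L1) Pq).
Qed.

Lemma generic_meets (P : V -> Prop) : definable (fun e => P (e 0)) ->
  (forall p, p ∈ cond Q -> exists q, q ∈ cond Q /\ le Q q p /\ P q) ->
  exists p, p ∈ G /\ P p.
Proof.
intros DP H; destruct (proj1 hG) as (_ & (p0 & G0) & _).
exact (generic_below DP G0 (fun p Hp _ => H p Hp)).
Qed.

End Generic.

Ltac dgraph DE Dle := repeat first
  [apply dterm_pair|apply (def_rel3 DE)|apply (def_rel2 Dle)|dstep].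

(** Equality of the values of a [Q]-labelled graph [E], where a node [x] has the value
    [{v y | E p y x, p ∈ G}].  The relation [D] is forced equality, obtained as a least
    fixed point in [M].  Being a fixed point determines its meaning, by induction on the
    values, so [E] need not be well-founded. *)
Lemma graph_equality (Q : notion) (E : V -> V -> V -> Prop) (K : V) :
  M_notion Q -> definable (fun e => E (e 0) (e 1) (e 2)) -> M K ->
  (forall p y x, p ∈ cond Q -> E p y x -> x ∈ K -> y ∈ K) ->
  exists D, M D /\ forall G v, generic M Q G ->
    (forall x, x ∈ K -> forall z, z ∈ v x <-> exists p y, p ∈ G /\ E p y x /\ z = v y) ->
    forall x y, x ∈ K -> y ∈ K -> (v x = v y <-> exists p, p ∈ G /\ ⟨p, ⟨x, y⟩⟩ ∈ D).
Proof.
intros hQ DE MK EK; assert (MC := M_cond hQ); assert (Dle := def_le hQ).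
assert (Lt := le_trans hQ).
(* One inclusion of forced equality: whenever [x1] enters [x], densely often some [y1] in [y] is
   related to it by [R]. *)
set (half := fun (R : V -> V -> V -> Prop) p x y =>
  forall p1, p1 ∈ cond Q -> forall x1, x1 ∈ K -> E p1 x1 x ->
  forall q, q ∈ cond Q -> le Q q p -> le Q q p1 ->
  exists r, r ∈ cond Q /\ le Q r q /\
  exists p2, p2 ∈ cond Q /\ exists y1, y1 ∈ K /\ E p2 y1 y /\ le Q r p2 /\ R r x1 y1).
set (step := fun X p x y => half (fun r a b => ⟨r, ⟨a, b⟩⟩ ∈ X) p x y /\
  half (fun r b a => ⟨r, ⟨a, b⟩⟩ ∈ X) p y x).
assert (hmono : forall (R S : V -> V -> V -> Prop) p x y,
  (forall r a b, R r a b -> S r a b) -> half R p x y -> half S p x y).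
{ intros R S p x y H H1 p1 Hp1 x1 Hx1 E1 q Hq L1 L2.
  destruct (H1 p1 Hp1 x1 Hx1 E1 q Hq L1 L2)
    as (r & Hr & L & p2 & Hp2 & y1 & Hy1 & E2 & L' & C).
  exists r; repeat split; auto; exists p2; split; [exact Hp2|]; exists y1; auto. }
(* Knaster-Tarski inside [M]: [D] is the intersection of all sets of [M] closed under [step]. *)
destruct (M_sep (P := fun w => forall X, M X ->
    (forall p, p ∈ cond Q -> forall x, x ∈ K -> forall y, y ∈ K ->
      step X p x y -> ⟨p, ⟨x, y⟩⟩ ∈ X) -> w ∈ X))
  with (x := prod (cond Q) (prod K K)) as (D & MD & KD).
{ unfold step, half; dgraph DE Dle. }
{ repeat apply M_prod; assumption. }
assert (Dpre : forall p x y, p ∈ cond Q -> x ∈ K -> y ∈ K ->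
  step D p x y -> ⟨p, ⟨x, y⟩⟩ ∈ D).
{ intros p x y Hp Hx Hy [H1 H2]; apply KD; split.
  - apply in_prod; exists p, ⟨x, y⟩; repeat split; auto; apply in_prod; eauto.
  - intros X MX HX; apply HX; auto; split; [revert H1|revert H2]; apply hmono;
      intros r a b Hr; apply KD in Hr; apply Hr; assumption. }
(* The set [X] of triples satisfying [step D] is contained in [D], hence closed under [step] by
   monotonicity; leastness then gives the converse inclusion. *)
assert (Dpost : forall p x y, ⟨p, ⟨x, y⟩⟩ ∈ D -> p ∈ cond Q /\ x ∈ K /\ y ∈ K /\ step D p x y).
{ destruct (M_sep (P := fun w => exists p, p ∈ cond Q /\ exists x, x ∈ K /\ exists y, y ∈ K /\
      w = ⟨p, ⟨x, y⟩⟩ /\ step D p x y)) with (x := prod (cond Q) (prod K K))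
    as (X & MX & KX).
  { unfold step, half; dgraph DE Dle. }
  { repeat apply M_prod; assumption. }
  intros p x y H; assert (HX : ⟨p, ⟨x, y⟩⟩ ∈ X).
  { apply KD in H; apply H; [exact MX|]; clear p x y H.
    intros p Hp x Hx y Hy [H1 H2]; apply KX; split.
    - apply in_prod; exists p, ⟨x, y⟩; repeat split; auto; apply in_prod; eauto.
    - exists p; split; [exact Hp|]; exists x; split; [exact Hx|]; exists y.
      split; [exact Hy|]; split; [reflexivity|].
      split; [revert H1|revert H2]; apply hmono; intros r a b Hr; apply KX in Hr;
        destruct Hr as (_ & p' & Hp' & x' & Hx' & y' & Hy' & E' & St);
        apply pair_inj in E'; destruct E' as [-> E']; apply pair_inj in E';
        destruct E' as [-> ->]; auto. }
  apply KX in HX; destruct HX as (_ & p' & Hp' & x' & Hx' & y' & Hy' & E' & St).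
  apply pair_inj in E'; destruct E' as [-> E']; apply pair_inj in E'.
  destruct E' as [-> ->]; auto. }
assert (hdown : forall (R : V -> V -> V -> Prop) p q x y,
  le Q q p -> half R p x y -> half R q x y)
  by (intros R p q x y L H p1 Hp1 x1 Hx1 E1 q' Hq' L1 L2;
      exact (H p1 Hp1 x1 Hx1 E1 q' Hq' (Lt _ _ _ L1 L) L2)).
assert (Ddown : forall p q x y, ⟨p, ⟨x, y⟩⟩ ∈ D -> q ∈ cond Q -> le Q q p -> ⟨q, ⟨x, y⟩⟩ ∈ D).
{ intros p q x y H Hq L; destruct (Dpost _ _ _ H) as (Hp & Hx & Hy & H1 & H2).
  apply Dpre; auto; split; eauto. }
exists D; split; [exact MD|]; intros G v hG Hv.
assert (Gc := generic_cond hG); assert (Gu := generic_up hG); assert (Gm := generic_common hG).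
assert (Kin : forall p y x, p ∈ G -> E p y x -> x ∈ K -> M y /\ y ∈ K /\ v y ∈ v x).
{ intros p y x Hp Hy Hx; assert (H : y ∈ K) by exact (EK p y x (Gc p Hp) Hy Hx).
  split; [exact (M_trans MK H)|]; split; [exact H|]; apply Hv; eauto. }
assert (Mof : forall x, x ∈ K -> M x) by (intros x Hx; exact (M_trans MK Hx)).
(* Induction on the value [z] of [x], not on the node [x]; only the values are known to be
   well-founded. *)
assert (sound : forall z x y p, z = v x -> p ∈ G -> ⟨p, ⟨x, y⟩⟩ ∈ D -> v x = v y).
{ intro z; induction (mem_wf z) as [z _ IH]; intros x y p -> Gp HD.
  destruct (Dpost _ _ _ HD) as (Hp & Hx & Hy & H1 & H2).
  apply subset_antisym; intros z Hz.
  - apply (Hv x Hx) in Hz; destruct Hz as (p1 & x1 & Gp1 & E1 & ->).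
    destruct (Kin _ _ _ Gp1 E1 Hx) as (Mx1 & Hx1 & Vx1).
    destruct (Gm p p1 Gp Gp1) as (p0 & Gp0 & L1 & L2).
    destruct (generic_below hQ hG (P := fun r => exists p2, p2 ∈ cond Q /\ exists y1, y1 ∈ K /\
        E p2 y1 y /\ le Q r p2 /\ ⟨r, ⟨x1, y1⟩⟩ ∈ D) (p0 := p0))
      as (r & Gr & p2 & Hp2 & y1 & Hy1 & E2 & L & C).
    + assert (My := Mof y Hy); dgraph DE Dle.
    + exact Gp0.
    + intros q Hq L.
      exact (H1 p1 (Gc _ Gp1) x1 Hx1 E1 q Hq (Lt _ _ _ L L1) (Lt _ _ _ L L2)).
    + rewrite (IH _ Vx1 x1 y1 r eq_refl Gr C); apply Hv; eauto 6.
  - apply (Hv y Hy) in Hz; destruct Hz as (p1 & y1 & Gp1 & E1 & ->).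
    destruct (Kin _ _ _ Gp1 E1 Hy) as (My1 & Hy1 & Vy1).
    destruct (Gm p p1 Gp Gp1) as (p0 & Gp0 & L1 & L2).
    destruct (generic_below hQ hG (P := fun r => exists p2, p2 ∈ cond Q /\ exists x1, x1 ∈ K /\
        E p2 x1 x /\ le Q r p2 /\ ⟨r, ⟨x1, y1⟩⟩ ∈ D) (p0 := p0))
      as (r & Gr & p2 & Hp2 & x1 & Hx1 & E2 & L & C).
    + assert (Mx := Mof x Hx); dgraph DE Dle.
    + exact Gp0.
    + intros q Hq L.
      exact (H2 p1 (Gc _ Gp1) y1 Hy1 E1 q Hq (Lt _ _ _ L L1) (Lt _ _ _ L L2)).
    + assert (Vx1 : v x1 ∈ v x) by (apply Hv; eauto 6).
      rewrite <- (IH _ Vx1 x1 y1 r eq_refl Gr C); exact Vx1. }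
intros x y Hx Hy; split; [|intros (p & Gp & HD); exact (sound _ x y p eq_refl Gp HD)].
assert (complete : forall z x y, z = v x -> x ∈ K -> y ∈ K -> v x = v y ->
  exists p, p ∈ G /\ ⟨p, ⟨x, y⟩⟩ ∈ D); [|intro H; exact (complete _ x y eq_refl Hx Hy H)].
clear x y Hx Hy; intro z; induction (mem_wf z) as [z _ IH]; intros x y -> Hx Hy Exy.
(* A bad [p] puts [x1] into [x] and excludes every related member of [y] below [p]. When the values
   agree, [G] contains no bad condition by induction, and a condition without bad extensions
   satisfies [step D]. *)
set (bad := fun (R : V -> V -> V -> Prop) x y p =>
  exists p1, p1 ∈ cond Q /\ exists x1, x1 ∈ K /\ E p1 x1 x /\ le Q p p1 /\
  forall q, q ∈ cond Q -> le Q q p -> forall p2, p2 ∈ cond Q -> forall y1, y1 ∈ K ->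
    E p2 y1 y -> le Q q p2 -> ~ R q x1 y1).
destruct (generic_decides hQ hG (P := fun p => bad (fun r a b => ⟨r, ⟨a, b⟩⟩ ∈ D) x y p \/
    bad (fun r b a => ⟨r, ⟨a, b⟩⟩ ∈ D) y x p)) as (p & Gp & [[B|B]|N]).
- assert (Mx := Mof x Hx); assert (My := Mof y Hy); unfold bad; dgraph DE Dle.
- exfalso; destruct B as (p1 & Hp1 & x1 & Hx1 & E1 & L1 & B).
  assert (Vx1 : v x1 ∈ v x) by (apply Hv; eauto 6).
  assert (W := Vx1); rewrite Exy in W; apply (Hv y Hy) in W.
  destruct W as (p2 & y1 & Gp2 & E2 & Ev); destruct (Kin _ _ _ Gp2 E2 Hy) as (_ & Hy1 & _).
  destruct (IH _ Vx1 x1 y1 eq_refl Hx1 Hy1 Ev) as (p' & Gp' & C).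
  destruct (Gm p p' Gp Gp') as (q & Gq & L2 & L3), (Gm q p2 Gq Gp2) as (r & Gr & L4 & L5).
  apply (B r (Gc r Gr) (Lt _ _ _ L4 L2) p2 (Gc _ Gp2) y1 Hy1 E2 L5); eauto.
- exfalso; destruct B as (p1 & Hp1 & y1 & Hy1 & E1 & L1 & B).
  assert (W : v y1 ∈ v x) by (rewrite Exy; apply Hv; eauto 6).
  assert (Vy1 := W); apply (Hv x Hx) in W.
  destruct W as (p2 & x1 & Gp2 & E2 & Ev); destruct (Kin _ _ _ Gp2 E2 Hx) as (_ & Hx1 & Vx1).
  destruct (IH _ Vx1 x1 y1 eq_refl Hx1 Hy1 (eq_sym Ev)) as (p' & Gp' & C).
  destruct (Gm p p' Gp Gp') as (q & Gq & L2 & L3), (Gm q p2 Gq Gp2) as (r & Gr & L4 & L5).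
  apply (B r (Gc r Gr) (Lt _ _ _ L4 L2) p2 (Gc _ Gp2) x1 Hx1 E2 L5); eauto.
- exists p; split; [exact Gp|]; apply Dpre; auto.
  split; intros p1 Hp1 x1 Hx1 E1 q Hq L1 L2; apply NNPP; intro C; apply (N q Hq L1);
    [left|right]; exists p1; (split; [exact Hp1|]); exists x1; repeat split; auto;
    intros r Hr L p2 Hp2 y1 Hy1 E2 L' HR; apply C; exists r; repeat split; auto;
    exists p2; (split; [exact Hp2|]); exists y1; auto.
Qed.

(** * Cohen names and the group action *)

(** The usual names for unordered and ordered pairs. An [Inj]-name is a set of pairs, so a Cohen
    name for it is assembled from names of pairs. *)
Definition upname (s t : V) : V := upair ⟨empty, s⟩ ⟨empty, t⟩.
Definition pairname (s t : V) : V := upname (upname s s) (upname s t).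

Lemma M_pairname s t : M s -> M t -> M (pairname s t).
Proof. assert (H := M_empty); intros; unfold pairname, upname; auto 10 using M_upair, M_pair. Qed.

Lemma dterm_pairname s t : dterm s -> dterm t -> dterm (fun e => pairname (s e) (t e)).
Proof.
intros Hs Ht; assert (H : dterm (fun _ => empty)) by apply dterm_const, M_empty.
assert (U : forall s t, dterm s -> dterm t -> dterm (fun e => upname (s e) (t e)))
  by (intros; apply dterm_upair; apply dterm_pair; assumption).
apply U; apply U; assumption.
Qed.

Lemma val_upname G s t : empty ∈ G -> val G (upname s t) = upair (val G s) (val G t).
Proof.
intro H; apply set_ext; intro z; rewrite in_val, in_upair; split.
- intros (p & u & K & _ & ->); apply in_upair in K.
  destruct K as [K|K]; apply pair_inj in K; destruct K as [_ ->]; auto.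
- intros [->| ->]; [exists empty, s|exists empty, t];
    (split; [apply in_upair; auto|split; [exact H|reflexivity]]).
Qed.

Lemma val_pairname G s t : empty ∈ G -> val G (pairname s t) = ⟨val G s, val G t⟩.
Proof. intro H; unfold pairname; rewrite !val_upname by exact H; reflexivity. Qed.

Lemma val_chk G x : empty ∈ G -> val G (chk x) = x.
Proof.
intro H; induction (mem_wf x) as [x _ IH]; apply set_ext; intro z; rewrite in_val; split.
- intros (p & s & K & _ & ->); apply in_chk in K; destruct K as (y & Hy & K).
  apply pair_inj in K; destruct K as [_ ->]; rewrite IH; exact Hy.
- intro Hz; exists empty, (chk z); split; [apply in_chk; eauto|].
  split; [exact H|symmetry; apply IH, Hz].
Qed.

Lemma name_chk Q x : empty ∈ cond Q -> name Q (chk x).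
Proof.
intro H; induction (mem_wf x) as [x _ IH]; constructor; intros z Hz.
apply in_chk in Hz; destruct Hz as (y & Hy & ->); eauto 6.
Qed.

Lemma name_upname Q s t : empty ∈ cond Q -> name Q s -> name Q t -> name Q (upname s t).
Proof.
intros H Hs Ht; constructor; intros z Hz; apply in_upair in Hz; destruct Hz as [->| ->]; eauto 6.
Qed.

Lemma name_pairname Q s t : empty ∈ cond Q -> name Q s -> name Q t -> name Q (pairname s t).
Proof. intros; unfold pairname; auto using name_upname. Qed.

Lemma act_cond_empty f : act_cond f empty = empty.
Proof.
apply set_ext; intro z; rewrite in_act_cond; split.
- intros (i & j & b & H & _); destruct (in_empty _ H).
- intro H; destruct (in_empty _ H).
Qed.

Lemma act_chk f x : act f (chk x) = chk x.
Proof.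
induction (mem_wf x) as [x _ IH]; apply set_ext; intro z; rewrite in_act, in_chk; split.
- intros (p & s & K & ->); apply in_chk in K; destruct K as (y & Hy & K).
  apply pair_inj in K; destruct K as [-> ->]; exists y; rewrite act_cond_empty, IH; auto.
- intros (y & Hy & ->); exists empty, (chk y); rewrite act_cond_empty, IH by exact Hy.
  split; [apply in_chk; eauto|reflexivity].
Qed.

Lemma act_upname f s t : act f (upname s t) = upname (act f s) (act f t).
Proof.
apply set_ext; intro z; unfold upname; rewrite in_act, in_upair; split.
- intros (p & u & K & ->); apply in_upair in K; destruct K as [K|K]; apply pair_inj in K;
    destruct K as [-> ->]; rewrite act_cond_empty; auto.
- intros [->| ->]; [exists empty, s|exists empty, t]; rewrite act_cond_empty;
    (split; [apply in_upair; auto|reflexivity]).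
Qed.

Lemma act_pairname f s t : act f (pairname s t) = pairname (act f s) (act f t).
Proof. unfold pairname; rewrite !act_upname; reflexivity. Qed.

Lemma symmetric_fixed t : (forall f, in_group f -> act f t = t) -> symmetric t.
Proof. intro H; exists 0; intros f [Hf _]; auto. Qed.

Lemma hs_chk x : hereditarily_symmetric (chk x).
Proof.
induction (mem_wf x) as [x _ IH]; constructor.
- apply symmetric_fixed; intros f _; apply act_chk.
- intros p s H; apply in_chk in H; destruct H as (y & Hy & E).
  apply pair_inj in E; destruct E as [_ ->]; auto.
Qed.

Lemma hs_upname s t :
  hereditarily_symmetric s -> hereditarily_symmetric t -> hereditarily_symmetric (upname s t).
Proof.
intros Hs Ht; constructor.
- destruct Hs as [s [m Hm] _], Ht as [t [n Hn] _]; exists (m + n); intros f [Hf K].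
  rewrite act_upname, Hm, Hn; [reflexivity| |]; (split; [exact Hf|]; intros; apply K; lia).
- intros p u H; apply in_upair in H; destruct H as [H|H]; apply pair_inj in H;
    destruct H as [_ ->]; assumption.
Qed.

Lemma hs_pairname s t :
  hereditarily_symmetric s -> hereditarily_symmetric t -> hereditarily_symmetric (pairname s t).
Proof. intros; unfold pairname; auto using hs_upname. Qed.

(** * Cohen conditions and their images under permutations *)

Local Notation P := (cond cohen).
Local Notation I := (cond inj_omega).

Lemma finite_image (R : V -> V -> Prop) p q : finite p ->
  (forall z, z ∈ q -> exists w, w ∈ p /\ R w z) ->
  (forall w z z', R w z -> R w z' -> z = z') -> finite q.
Proof.
intros [l Hl] H1 H2; exists (map (fun w => epsilon (inhabits empty) (R w)) l).
intros z Hz; destruct (H1 z Hz) as (w & Hw & K); apply in_map_iff; exists w.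
split; [|auto]; apply (H2 w); [apply epsilon_spec; eauto|exact K].
Qed.

Lemma finite_cup x y : finite x -> finite y -> finite (cup x y).
Proof.
intros [l Hl] [m Hm]; exists (l ++ m); intros z Hz; apply in_app_iff.
apply in_cup in Hz; destruct Hz; auto.
Qed.

Lemma finite_empty : finite empty.
Proof. exists nil; intros z Hz; destruct (in_empty _ Hz). Qed.

Lemma in_P p : p ∈ P <-> finite p /\
  (forall z, z ∈ p -> exists i j b, z = ⟨⟨num i, num j⟩, b⟩ /\ b ∈ num 2) /\ single_valued p.
Proof.
simpl; rewrite in_Fn; split.
- intros (H1 & H2 & H3); split; [exact H1|]; split; [|exact H3]; intros z Hz.
  apply H2, in_prod in Hz; destruct Hz as (a & b & Ha & Hb & ->).
  apply in_prod in Ha; destruct Ha as (i & j & Hi & Hj & ->); apply in_omega in Hi, Hj.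
  destruct Hi as [i' ->], Hj as [j' ->]; eauto.
- intros (H1 & H2 & H3); split; [exact H1|]; split; [|exact H3]; intros z Hz.
  destruct (H2 z Hz) as (i & j & b & -> & Hb); apply in_prod; exists ⟨num i, num j⟩, b.
  repeat split; [|exact Hb]; apply in_prod; exists (num i), (num j).
  repeat split; apply in_omega; eauto.
Qed.

Lemma in_P_elem p a b : p ∈ P -> ⟨a, b⟩ ∈ p ->
  exists i j, a = ⟨num i, num j⟩ /\ b ∈ num 2.
Proof.
intros Hp H; apply in_P in Hp; destruct (proj1 (proj2 Hp) _ H) as (i & j & b' & E & Hb).
apply pair_inj in E; destruct E as [-> ->]; eauto.
Qed.

Lemma empty_P : empty ∈ P.
Proof.
apply in_P; split; [exact finite_empty|]; split.
- intros z Hz; destruct (in_empty _ Hz).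
- intros a b b' H; destruct (in_empty _ H).
Qed.

Lemma empty_I : empty ∈ I.
Proof.
simpl; apply in_Inj; split; [exact finite_empty|]; split; [apply empty_subset|].
split; intros a b b' H; destruct (in_empty _ H).
Qed.

Lemma M_P : M P.
Proof. apply M_Fn; [apply M_prod; apply M_omega|apply M_num]. Qed.

Lemma M_I : M I.
Proof. apply M_Inj; apply M_omega. Qed.

Lemma M_cohen : M_notion cohen.
Proof.
split.
- exact M_P.
- simpl; unfold rev_incl; repeat dstep.
- intros p _ z Hz; exact Hz.
- intros p q r H1 H2 z Hz; exact (H1 z (H2 z Hz)).
Qed.

Lemma M_inj_omega : M_notion inj_omega.
Proof.
split; [exact M_I|simpl; unfold rev_incl; repeat dstep| |].
- intros p _ z Hz; exact Hz.
- intros p q r H1 H2 z Hz; exact (H1 z (H2 z Hz)).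
Qed.

Lemma in_act_bit f p i j b : (forall m n, f m = f n -> m = n) ->
  ⟨⟨num (f i), num j⟩, b⟩ ∈ act_cond f p <-> ⟨⟨num i, num j⟩, b⟩ ∈ p.
Proof.
intro Hf; rewrite in_act_cond; split; [|eauto 6].
intros (i' & j' & b' & H & E); apply pair_inj in E; destruct E as [E ->].
apply pair_inj in E; destruct E as [E1 E2]; apply num_inj in E1, E2.
apply Hf in E1; subst; exact H.
Qed.

Lemma act_cond_P f p : (forall m n, f m = f n -> m = n) -> p ∈ P -> act_cond f p ∈ P.
Proof.
intros Hf Hp; assert (K := Hp); apply in_P in K; destruct K as (H1 & H2 & H3).
apply in_P; split; [|split].
- apply finite_image with (p := p) (R := fun w z => exists i j b,
    w = ⟨⟨num i, num j⟩, b⟩ /\ z = ⟨⟨num (f i), num j⟩, b⟩); [exact H1| |].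
  + intros z Hz; apply in_act_cond in Hz; destruct Hz as (i & j & b & K & ->); eauto 10.
  + intros w z z' (i & j & b & -> & ->) (i' & j' & b' & E & ->).
    apply pair_inj in E; destruct E as [E <-]; apply pair_inj in E; destruct E as [E1 <-].
    apply num_inj in E1; subst; reflexivity.
- intros z Hz; apply in_act_cond in Hz; destruct Hz as (i & j & b & K & ->).
  destruct (in_P_elem Hp K) as (_ & _ & _ & Hb); eauto.
- intros a b b' H H'; assert (Ha := H); apply in_act_cond in Ha.
  destruct Ha as (i & j & b0 & _ & E); apply pair_inj in E; destruct E as [-> _].
  rewrite in_act_bit in H, H' by exact Hf; eauto.
Qed.

Lemma act_cond_inv f g p : (forall n, f (g n) = n) -> p ∈ P -> act_cond f (act_cond g p) = p.
Proof.
intros Hfg Hp; apply set_ext; intro z; rewrite in_act_cond; split.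
- intros (i & j & b & H & ->); apply in_act_cond in H; destruct H as (i' & j' & b' & H & E).
  apply pair_inj in E; destruct E as [E ->]; apply pair_inj in E; destruct E as [E ->].
  apply num_inj in E; subst; rewrite Hfg; exact H.
- intro Hz; destruct (proj1 (proj2 (proj1 (in_P p) Hp)) z Hz) as (i & j & b & -> & _).
  exists (g i), j, b; rewrite Hfg; split; [|reflexivity]; apply in_act_cond; eauto.
Qed.

Lemma swap_invol i j n : swap i j (swap i j n) = n.
Proof.
unfold swap; destruct (Nat.eqb_spec n i) as [->|E1]; [rewrite Nat.eqb_refl|].
- destruct (Nat.eqb_spec j i); congruence.
- destruct (Nat.eqb_spec n j) as [->|E2]; [rewrite Nat.eqb_refl; reflexivity|].
  rewrite (proj2 (Nat.eqb_neq n i) E1), (proj2 (Nat.eqb_neq n j) E2); reflexivity.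
Qed.

Lemma swap_inj i j m n : swap i j m = swap i j n -> m = n.
Proof. intro E; rewrite <- (swap_invol i j m), E; apply swap_invol. Qed.

Lemma swap_l i j : swap i j i = j.
Proof. unfold swap; rewrite Nat.eqb_refl; reflexivity. Qed.

Lemma swap_r i j : swap i j j = i.
Proof. rewrite <- (swap_l i j) at 2; apply swap_invol. Qed.

Lemma swap_other i j n : n <> i -> n <> j -> swap i j n = n.
Proof.
intros H1 H2; unfold swap.
rewrite (proj2 (Nat.eqb_neq n i) H1), (proj2 (Nat.eqb_neq n j) H2); reflexivity.
Qed.

Lemma group_bij f : in_group f -> exists g, (forall n, f (g n) = n) /\ (forall n, g (f n) = n).
Proof.
induction 1 as [i j Hij| |f f' _ (g & H1 & H2) _ (g' & K1 & K2)|f g _ _ H1 H2].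
- exists (swap i j); auto using swap_invol.
- exists (fun n => n); auto.
- exists (fun n => g' (g n)); split; intro n; [rewrite K1|rewrite H2]; auto.
- exists f; auto.
Qed.

Lemma group_injective f : in_group f -> forall m n, f m = f n -> m = n.
Proof.
intros Hf m n E; destruct (group_bij Hf) as (g & _ & H); rewrite <- (H m), E; apply H.
Qed.

Definition act_filter (f : nat -> nat) (G : V) : V := {{ q | exists p, p ∈ G /\ q = act_cond f p }}.

Lemma in_act_filter f G q : q ∈ act_filter f G <-> exists p, p ∈ G /\ q = act_cond f p.
Proof.
apply (@in_compr (fun q => exists p, p ∈ G /\ q = act_cond f p)).
apply small_repl; [apply small_mem|congruence].
Qed.

(** Moving the name and the filter by the same permutation cancels, since [act_cond f] can be undone
    on conditions by the inverse of [f]. *)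
Lemma val_act f G t : in_group f -> G ⊆ P -> name cohen t ->
  val (act_filter f G) (act f t) = val G t.
Proof.
intros Hf HG; destruct (group_bij Hf) as (g & _ & Hgf).
induction (subname_wf t) as [t _ IH]; intro Ht; destruct Ht as [t Ht].
assert (N : forall p s, ⟨p, s⟩ ∈ t -> p ∈ P /\ name cohen s).
{ intros p s H; destruct (Ht _ H) as (p' & s' & Hp & Hs & E).
  apply pair_inj in E; destruct E as [-> ->]; auto. }
apply set_ext; intro z; rewrite !in_val; split.
- intros (q & u & H & Gq & ->); apply in_act in H; destruct H as (p & s & H & E).
  apply pair_inj in E; destruct E as [-> ->]; destruct (N _ _ H) as [Hp Hs].
  apply in_act_filter in Gq; destruct Gq as (p' & Gp' & E).
  exists p, s; split; [exact H|]; split; [|apply IH; [exists p|]; assumption].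
  rewrite <- (act_cond_inv (p := p) Hgf), E, act_cond_inv; auto.
- intros (p & s & H & Gp & ->); destruct (N _ _ H) as [Hp Hs].
  exists (act_cond f p), (act f s); split; [apply in_act; eauto|].
  split; [apply in_act_filter; eauto|symmetry; apply IH; [exists p|]; assumption].
Qed.

(** A Cohen name whose value is an [Inj]-name, the check name of the Cohen real [i]. *)
Definition real_name (i : V) : V :=
  {{ z | exists p, p ∈ P /\ exists m, m ∈ omega /\
         ⟨⟨i, m⟩, num 1⟩ ∈ p /\ z = ⟨p, chk ⟨empty, chk m⟩⟩ }}.

(** One bound [B] serves every [i]; with it, being equal to [real_name i] is expressed by bounded
    quantifiers in [def_real_name]. *)
Lemma real_name_spec : exists B, M B /\ forall i, M i -> M (real_name i) /\
  forall z, (z ∈ real_name i <-> exists p, p ∈ P /\ exists m, m ∈ omega /\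
    ⟨⟨i, m⟩, num 1⟩ ∈ p /\ z = ⟨p, chk ⟨empty, chk m⟩⟩) /\ (z ∈ real_name i -> z ∈ B).
Proof.
assert (ME := M_empty); assert (MP := M_P); assert (MO := M_omega); assert (M1 := M_num 1).
destruct (M_image (F := fun m => chk ⟨empty, chk m⟩)) with (x := omega) as (B & MB & KB).
{ auto using M_chk, M_pair. }
{ repeat first [apply dterm_pair|apply dterm_chk|dstep]. }
{ exact MO. }
exists (prod P B); split; [apply M_prod; assumption|]; intros i Mi.
set (R := fun z => exists p, p ∈ P /\ exists m, m ∈ omega /\
         ⟨⟨i, m⟩, num 1⟩ ∈ p /\ z = ⟨p, chk ⟨empty, chk m⟩⟩).
destruct (M_sep (P := R)) with (x := prod P B) as (Z & MZ & KZ).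
{ unfold R; repeat first [apply dterm_pair|apply dterm_chk|dstep]. }
{ apply M_prod; assumption. }
assert (K : forall z, z ∈ Z <-> R z).
{ intro z; rewrite KZ; split; [tauto|]; intro H; split; [|exact H].
  destruct H as (p & Hp & m & Hm & _ & ->); apply in_prod; exists p, (chk ⟨empty, chk m⟩).
  repeat split; [exact Hp|]; apply KB; eauto. }
assert (E : real_name i = Z) by exact (compr_eq K).
rewrite E; split; [exact MZ|]; intro z; split; [apply K|intro Hz; apply KZ, Hz].
Qed.

Lemma M_real_name i : M i -> M (real_name i).
Proof. destruct real_name_spec as (B & _ & H); apply H. Qed.

Lemma in_real_name i z : M i -> z ∈ real_name i <-> exists p, p ∈ P /\ exists m, m ∈ omega /\
  ⟨⟨i, m⟩, num 1⟩ ∈ p /\ z = ⟨p, chk ⟨empty, chk m⟩⟩.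
Proof. destruct real_name_spec as (B & _ & H); intro Mi; apply (H i Mi). Qed.

Lemma def_real_name : definable (fun e => e 0 = real_name (e 1)).
Proof.
assert (ME := M_empty); assert (MP := M_P); assert (MO := M_omega); assert (M1 := M_num 1).
destruct real_name_spec as (B & MB & H).
apply (@def_ext (fun e =>
  (forall z, z ∈ e 0 -> z ∈ B) /\ (forall z, z ∈ B -> (z ∈ e 0 <->
     exists p, p ∈ P /\ exists m, m ∈ omega /\
         ⟨⟨e 1, m⟩, num 1⟩ ∈ p /\ z = ⟨p, chk ⟨empty, chk m⟩⟩)))).
- repeat first [apply dterm_pair|apply dterm_chk|apply def_iff|dstep].
- intros e He; destruct (H (e 1) (He 1)) as (MZ & KZ); split.
  + intros [H1 H2]; apply set_ext; intro z; split; intro Hz.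
    * apply KZ, H2; auto.
    * destruct (KZ z) as [K1 K2]; apply H2; [exact (K2 Hz)|apply K1, Hz].
  + intros ->; split; intro z; [|intros _]; apply KZ.
Qed.

(** The singleton of the pair of 0 and [n], with [empty] in the role of the number 0 and not of the
    weakest condition. *)
Definition start (n : V) : V := upair ⟨empty, n⟩ ⟨empty, n⟩.

(** [start n] forces [g(0) = n], so this is a Cohen name whose value is an [Inj]-name of the
    set of Cohen reals containing [g(0)]. *)
Definition family_name : V :=
  {{ z | exists p, p ∈ P /\ exists i, i ∈ omega /\ exists n, n ∈ omega /\
         ⟨⟨i, n⟩, num 1⟩ ∈ p /\ z = ⟨p, pairname (chk (start n)) (real_name i)⟩ }}.

Lemma family_name_spec : M family_name /\
  forall z, z ∈ family_name <-> exists p, p ∈ P /\ exists i, i ∈ omega /\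
    exists n, n ∈ omega /\ ⟨⟨i, n⟩, num 1⟩ ∈ p /\
    z = ⟨p, pairname (chk (start n)) (real_name i)⟩.
Proof.
assert (ME := M_empty); assert (MP := M_P); assert (MO := M_omega); assert (M1 := M_num 1).
assert (Mstart : forall n, M n -> M (start n)) by (intros; apply M_upair; apply M_pair; auto).
destruct (M_image2 (F := fun i n => pairname (chk (start n)) (real_name i)))
  with (x := omega) (y := omega) as (B & MB & KB).
{ auto using M_chk, M_pairname, M_real_name. }
{ apply def_eq; [apply dterm_var|]; unfold start.
  repeat first [apply dterm_pairname|apply dterm_pair|apply dterm_chk|apply dterm_upair
    |apply (dterm_fun1 M_real_name def_real_name)|dstep]. }
{ exact MO. }
{ exact MO. }
destruct (M_sep (P := fun z => exists p, p ∈ P /\ exists i, i ∈ omega /\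
    exists n, n ∈ omega /\ ⟨⟨i, n⟩, num 1⟩ ∈ p /\
    z = ⟨p, pairname (chk (start n)) (real_name i)⟩)) with (x := prod P B) as (Z & MZ & KZ).
{ unfold start.
  repeat first [apply dterm_pairname|apply dterm_pair|apply dterm_chk|apply dterm_upair
    |apply (dterm_fun1 M_real_name def_real_name)|dstep]. }
{ apply M_prod; assumption. }
assert (K : forall z, z ∈ Z <-> exists p, p ∈ P /\ exists i, i ∈ omega /\
    exists n, n ∈ omega /\ ⟨⟨i, n⟩, num 1⟩ ∈ p /\
    z = ⟨p, pairname (chk (start n)) (real_name i)⟩).
{ intro z; rewrite KZ; split; [tauto|]; intro H; split; [|exact H].
  destruct H as (p & Hp & i & Hi & n & Hn & _ & ->); apply in_prod.
  exists p, (pairname (chk (start n)) (real_name i)); repeat split; [exact Hp|].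
  apply KB; eauto. }
assert (E : family_name = Z) by exact (compr_eq K).
rewrite E; auto.
Qed.

Section Names.

Variable f : nat -> nat.
Variable hf : in_group f.

(** A condition puts [m] into row [i] exactly when its image puts [m] into row [f i]. *)
Lemma act_real_name i : act f (real_name (num i)) = real_name (num (f i)).
Proof.
destruct (group_bij hf) as (g & Hfg & Hgf); assert (Hf := group_injective hf).
assert (Hg : forall m n, g m = g n -> m = n)
  by (intros m n E; rewrite <- (Hfg m), E; apply Hfg).
apply set_ext; intro z; rewrite in_act, in_real_name by apply M_num; split.
- intros (p & s & H & ->); apply in_real_name in H; [|apply M_num].
  destruct H as (p' & Hp & m & Hm & B & E); apply pair_inj in E; destruct E as [-> ->].
  rewrite act_chk; exists (act_cond f p'); split; [apply act_cond_P; assumption|].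
  exists m; repeat split; [exact Hm|]; apply in_omega in Hm; destruct Hm as [k ->].
  apply in_act_bit; assumption.
- intros (p & Hp & m & Hm & B & ->); exists (act_cond g p), (chk ⟨empty, chk m⟩).
  rewrite act_chk, (act_cond_inv Hfg Hp); split; [|reflexivity].
  apply in_real_name; [apply M_num|].
  exists (act_cond g p); split; [apply act_cond_P; assumption|].
  exists m; repeat split; [exact Hm|]; apply in_omega in Hm; destruct Hm as [k ->].
  rewrite <- (Hgf i); apply in_act_bit; assumption.
Qed.

(** The whole group fixes this name: it merely permutes the index [i], over which the family ranges
    freely. *)
Lemma act_family_name : act f family_name = family_name.
Proof.
destruct (group_bij hf) as (g & Hfg & Hgf); assert (Hf := group_injective hf).
assert (Hg : forall m n, g m = g n -> m = n)
  by (intros m n E; rewrite <- (Hfg m), E; apply Hfg).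
destruct family_name_spec as [_ K].
apply set_ext; intro z; rewrite in_act, K; split.
- intros (p & s & H & ->); apply K in H.
  destruct H as (p' & Hp & i & Hi & n & Hn & B & E); apply pair_inj in E; destruct E as [-> ->].
  apply in_omega in Hi, Hn; destruct Hi as [i' ->], Hn as [n' ->].
  rewrite act_pairname, act_chk, act_real_name.
  exists (act_cond f p'); split; [apply act_cond_P; assumption|].
  exists (num (f i')); split; [apply in_omega; eauto|].
  exists (num n'); split; [apply in_omega; eauto|]; split; [apply in_act_bit; assumption|auto].
- intros (p & Hp & i & Hi & n & Hn & B & ->).
  apply in_omega in Hi, Hn; destruct Hi as [i' ->], Hn as [n' ->].
  exists (act_cond g p), (pairname (chk (start (num n'))) (real_name (num (g i')))).
  rewrite act_pairname, act_chk, act_real_name, Hfg, (act_cond_inv Hfg Hp).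
  split; [|reflexivity]; apply K.
  exists (act_cond g p); split; [apply act_cond_P; assumption|].
  exists (num (g i')); split; [apply in_omega; eauto|].
  exists (num n'); split; [apply in_omega; eauto|]; split; [apply in_act_bit; assumption|auto].
Qed.

End Names.

Lemma name_real_name i : M i -> name cohen (real_name i).
Proof.
intro Mi; constructor; intros z Hz; apply in_real_name in Hz; [|exact Mi].
destruct Hz as (p & Hp & m & _ & _ & ->); exists p, (chk ⟨empty, chk m⟩).
auto using name_chk, empty_P.
Qed.

Lemma hs_real_name i : hereditarily_symmetric (real_name (num i)).
Proof.
constructor.
(* The support is [S i], because the subgroup for [n] fixes only the numbers strictly below [n]. *)
- exists (S i); intros f [Hf K]; rewrite act_real_name, K by (assumption || lia); reflexivity.
- intros p s H; apply in_real_name in H; [|apply M_num].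
  destruct H as (p' & _ & m & _ & _ & E); apply pair_inj in E; destruct E as [_ ->].
  apply hs_chk.
Qed.

Lemma name_family_name : name cohen family_name.
Proof.
constructor; intros z Hz; apply family_name_spec in Hz.
destruct Hz as (p & Hp & i & Hi & n & Hn & _ & ->).
exists p, (pairname (chk (start n)) (real_name i)); split; [exact Hp|].
split; [|reflexivity].
assert (E := empty_P); apply name_pairname; [exact E|apply name_chk, E|].
apply name_real_name, (M_trans M_omega Hi).
Qed.

Lemma hs_family_name : hereditarily_symmetric family_name.
Proof.
constructor; [apply symmetric_fixed; exact act_family_name|].
intros p s H; apply family_name_spec in H.
destruct H as (p' & _ & i & Hi & n & Hn & _ & E); apply pair_inj in E; destruct E as [_ ->].
apply in_omega in Hi; destruct Hi as [i' ->].
apply hs_pairname; [apply hs_chk|apply hs_real_name].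
Qed.

(** * Cohen reals and the values of the names *)

Definition real (G i : V) : V := {{ m | m ∈ omega /\ exists p, p ∈ G /\ ⟨⟨i, m⟩, num 1⟩ ∈ p }}.

Lemma in_real G i m : m ∈ real G i <-> m ∈ omega /\ exists p, p ∈ G /\ ⟨⟨i, m⟩, num 1⟩ ∈ p.
Proof.
apply (@in_compr (fun m => m ∈ omega /\ exists p, p ∈ G /\ ⟨⟨i, m⟩, num 1⟩ ∈ p)).
apply small_sub with (2 := small_mem omega); tauto.
Qed.

Lemma val_real_name G i : M i -> empty ∈ G -> G ⊆ P -> val G (real_name i) = chk (real G i).
Proof.
intros Mi HE HG; apply set_ext; intro z; rewrite in_val, in_chk; split.
- intros (p & s & H & Gp & ->); apply in_real_name in H; [|exact Mi].
  destruct H as (p' & _ & m & Hm & B & E); apply pair_inj in E; destruct E as [-> ->].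
  exists m; split; [apply in_real; eauto|apply val_chk, HE].
- intros (m & Hm & ->); apply in_real in Hm; destruct Hm as (Hm & p & Gp & B).
  exists p, (chk ⟨empty, chk m⟩); rewrite val_chk by exact HE; split; [|auto].
  apply in_real_name; eauto 8.
Qed.

Lemma in_family G w : empty ∈ G -> G ⊆ P -> w ∈ val G family_name <->
  exists i n, num n ∈ real G (num i) /\ w = ⟨start (num n), chk (real G (num i))⟩.
Proof.
intros HE HG; rewrite in_val; destruct family_name_spec as [_ K]; split.
- intros (p & s & H & Gp & ->); apply K in H.
  destruct H as (p' & _ & i & Hi & n & Hn & B & E); apply pair_inj in E; destruct E as [-> ->].
  rewrite val_pairname, val_chk, val_real_name by (assumption || exact (M_trans M_omega Hi)).
  apply in_omega in Hi; destruct Hi as [i' ->].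
  assert (Hr : n ∈ real G (num i')) by (apply in_real; eauto).
  apply in_omega in Hn; destruct Hn as [n' ->]; eauto.
- intros (i & n & H & ->); apply in_real in H; destruct H as (Hn & p & Gp & B).
  exists p, (pairname (chk (start (num n))) (real_name (num i))).
  rewrite val_pairname, val_chk, val_real_name by (assumption || apply M_num).
  split; [|auto]; apply K; exists p; split; [auto|]; exists (num i).
  split; [apply in_omega; eauto|eauto].
Qed.

(** A name for a pair has a name for the unordered pair one level down and one for the second
    component two levels down. A transitive set containing [x] thus contains a name for [s]. *)
Lemma val_pair_snd G x b s : ⟨b, s⟩ = val G x ->
  exists p q y z, ⟨p, y⟩ ∈ x /\ ⟨q, z⟩ ∈ y /\ s = val G z.
Proof.
intro E; assert (H : upair b s ∈ val G x) by (rewrite <- E; apply in_upair; auto).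
apply in_val in H; destruct H as (p & y & Hy & _ & Ey).
assert (H : s ∈ val G y) by (rewrite <- Ey; apply in_upair; auto).
apply in_val in H; destruct H as (q & z & Hz & _ & Ez); eauto 8.
Qed.

(** * The product forcing *)

Definition cohen_inj : notion := Notion (prod P I)
  (fun x y => exists p b q d, x = ⟨p, b⟩ /\ y = ⟨q, d⟩ /\ q ⊆ p /\ d ⊆ b).

Lemma M_cohen_inj : M_notion cohen_inj.
Proof.
split.
- apply M_prod; [exact M_P|exact M_I].
- simpl; dsolve.
- intros w Hw; apply in_prod in Hw; destruct Hw as (p & b & _ & _ & ->).
  exists p, b, p, b; repeat split; intros z Hz; exact Hz.
- intros x y z (p & b & q & d & -> & -> & H1 & H2) (q' & d' & r & k & E & -> & H3 & H4).
  apply pair_inj in E; destruct E as [<- <-]; exists p, b, r, k.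
  repeat split; intros w Hw; auto.
Qed.

Lemma le_cohen_inj p b q d : le cohen_inj ⟨p, b⟩ ⟨q, d⟩ <-> q ⊆ p /\ d ⊆ b.
Proof.
split; [|intros []; exists p, b, q, d; auto].
intros (p' & b' & q' & d' & E & E' & H); apply pair_inj in E, E'.
destruct E as [-> ->], E' as [-> ->]; exact H.
Qed.

Lemma in_prod_pair a b x y : ⟨a, b⟩ ∈ prod x y <-> a ∈ x /\ b ∈ y.
Proof.
rewrite in_prod; split; [|intros []; exists a, b; auto].
intros (a' & b' & Ha & Hb & E); apply pair_inj in E; destruct E as [-> ->]; auto.
Qed.

Lemma filter_prod G H : is_filter cohen G -> is_filter inj_omega H ->
  is_filter cohen_inj (prod G H).
Proof.
intros (G1 & (g & Gg) & G3 & G4) (H1 & (h & Hh) & H3 & H4); split; [|split; [|split]].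
- intros w Hw; apply in_prod in Hw; destruct Hw as (p & b & Hp & Hb & ->).
  apply in_prod_pair; auto.
- exists ⟨g, h⟩; apply in_prod_pair; auto.
- intros x y Hx Hy (p & b & q & d & -> & -> & L1 & L2).
  apply in_prod_pair in Hx; destruct Hx as [Hp Hb].
  change (⟨q, d⟩ ∈ prod P I) in Hy; apply in_prod_pair in Hy.
  apply in_prod_pair; split; [apply (G3 p)|apply (H3 b)]; tauto.
- intros x y Hx Hy; apply in_prod in Hx, Hy.
  destruct Hx as (p & b & Hp & Hb & ->), Hy as (q & d & Hq & Hd & ->).
  destruct (G4 p q Hp Hq) as (r & Hr & L1 & L2), (H4 b d Hb Hd) as (k & Hk & L3 & L4).
  exists ⟨r, k⟩; rewrite in_prod_pair, !le_cohen_inj; auto.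
Qed.

Lemma generic_fst G H : is_filter cohen G -> generic M cohen_inj (prod G H) -> generic M cohen G.
Proof.
intros HG HGH; split; [exact HG|]; intros D MD [D1 D2].
destruct (proj2 HGH (prod D I)) as (w & Hw & GHw).
- apply M_prod; [exact MD|exact M_I].
- split.
  + intros w Hw; apply in_prod in Hw; destruct Hw as (p & b & Hp & Hb & ->).
    apply in_prod_pair; auto.
  + intros w Hw; apply in_prod in Hw; destruct Hw as (p & b & Hp & Hb & ->).
    destruct (D2 p Hp) as (q & Hq & L); exists ⟨q, b⟩; rewrite in_prod_pair, le_cohen_inj.
    repeat split; auto; intros z Hz; exact Hz.
- apply in_prod in Hw; destruct Hw as (p & b & Hp & Hb & ->).
  apply in_prod_pair in GHw; exists p; tauto.
Qed.

Lemma empty_generic Q G : generic M Q G -> empty ∈ cond Q -> (forall p, le Q p empty) ->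
  empty ∈ G.
Proof. intros ((_ & (p & Gp) & U & _) & _) HE HL; exact (U p empty Gp HE (HL p)). Qed.

(** Two applications of [graph_equality]: to the graph of Cohen names, and then to the graph
    whose nodes are Cohen names for [Inj]-names. *)
Lemma double_value_decided G H x y : M x -> M y ->
  generic M cohen G -> generic M cohen_inj (prod G H) -> val H (val G x) = val H (val G y) ->
  exists p b, p ∈ G /\ b ∈ H /\ forall G' H', generic M cohen G' ->
    generic M cohen_inj (prod G' H') -> p ∈ G' -> b ∈ H' ->
    val H' (val G' x) = val H' (val G' y).
Proof.
intros Mx My hG hGH Exy.
assert (MP := M_P); assert (MI := M_I).
destruct (M_transitive_closure (M_upair Mx My)) as (S & MS & TS & HS).
assert (Sx : x ∈ S) by (apply (TS _ HS), in_upair; auto).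
assert (Sy : y ∈ S) by (apply (TS _ HS), in_upair; auto).
assert (sub : forall T p s t, transitive T -> ⟨p, s⟩ ∈ t -> t ∈ T -> s ∈ T).
{ intros T p s t HT H1 H2; apply (HT (upair p s)); [|apply in_upair; auto].
  apply (HT ⟨p, s⟩); [exact (HT _ H2 _ H1)|apply in_upair; auto]. }
(* That the pair of [b] and the value of [s] belongs to the value of [t] is an equality between a
   member of [t] and [pairname (chk b) s]. Hence these names must be nodes of the first graph as
   well. *)
destruct (M_image2 (F := fun b s => pairname (chk b) s)) with (x := I) (y := S)
  as (N & MN & KN); auto using M_pairname, M_chk.
{ apply def_eq; [apply dterm_var|].
  repeat first [apply dterm_pairname|apply dterm_chk|dstep]. }
destruct (M_transitive_closure (M_upair MS MN)) as (K & MK & TK & HK).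
assert (SK : S ⊆ K) by (apply TK, (TK _ HK), in_upair; auto).
assert (NK : N ⊆ K) by (apply TK, (TK _ HK), in_upair; auto).
destruct (@graph_equality cohen (fun p s t => ⟨p, s⟩ ∈ t) K) as (D1 & MD1 & KD1).
{ exact M_cohen. }
{ repeat first [apply dterm_pair|dstep]. }
{ exact MK. }
{ intros p s t _ H1 H2; exact (sub K p s t TK H1 H2). }
(* An edge labelled by [p] and [b] says that [p] puts some [z] into [t] and, through [D1], forces
   [z] to be the pair of [b] and [s]. Here [s] ranges over all of [S], so edges need not follow the
   subname relation. *)
destruct (@graph_equality cohen_inj (fun w s t => s ∈ S /\ exists p, p ∈ P /\ exists b, b ∈ I /\
    w = ⟨p, b⟩ /\ exists u, u ∈ P /\ exists z, z ∈ S /\ ⟨u, z⟩ ∈ t /\ u ⊆ p /\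
    exists q, q ∈ P /\ q ⊆ p /\ ⟨q, ⟨z, pairname (chk b) s⟩⟩ ∈ D1) S) as (D2 & MD2 & KD2).
{ exact M_cohen_inj. }
{ repeat first [apply dterm_pairname|apply dterm_chk|apply dterm_pair|dstep]. }
{ exact MS. }
{ intros p s t _ [H1 _] _; exact H1. }
assert (V1 : forall G, generic M cohen G -> forall s t, s ∈ K -> t ∈ K ->
  (val G s = val G t <-> exists p, p ∈ G /\ ⟨p, ⟨s, t⟩⟩ ∈ D1)).
{ intros G0 hG0; apply (KD1 G0 (val G0) hG0); intros t _ z; rewrite in_val.
  split; intros (p & s & K1 & K2 & K3); eauto 6. }
assert (V2 : forall G H, generic M cohen G -> generic M cohen_inj (prod G H) ->
  forall s t, s ∈ S -> t ∈ S ->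
  (val H (val G s) = val H (val G t) <-> exists w, w ∈ prod G H /\ ⟨w, ⟨s, t⟩⟩ ∈ D2)).
{ clear G H hG hGH Exy; intros G H hG hGH.
  assert (GE : empty ∈ G)
    by (apply (empty_generic hG empty_P); intro; apply empty_subset).
  assert (HI : forall b, b ∈ H -> b ∈ I).
  { intros b Hb; destruct (proj1 (proj2 (proj1 hG))) as [g Gg].
    apply (proj2 (proj1 (in_prod_pair g b P I)
      (proj1 (proj1 hGH) _ (proj2 (in_prod_pair g b G H) (conj Gg Hb))))). }
  apply (KD2 (prod G H) (fun s => val H (val G s)) hGH); intros t St z.
  rewrite in_val; split.
  - intros (b & s & Hbs & Hb & ->); apply in_val in Hbs.
    destruct Hbs as (u & c & Huc & Gu & E); assert (Sc := sub S u c t TS Huc St).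
    destruct (val_pair_snd E) as (k & k' & d & s' & H1 & H2 & ->).
    assert (Ss : s' ∈ S) by eauto.
    rewrite <- (val_chk b GE), <- val_pairname in E by exact GE; symmetry in E.
    assert (Kp : pairname (chk b) s' ∈ K) by (apply NK, KN; exists b, s'; auto).
    apply (V1 G hG c _ (SK _ Sc) Kp) in E; destruct E as (q & Gq & Dq).
    destruct (generic_common hG Gu Gq) as (p & Gp & L1 & L2).
    exists ⟨p, b⟩, s'; rewrite in_prod_pair; repeat split; auto.
    exists p; split; [exact (generic_cond hG Gp)|]; exists b; split; [auto|].
    split; [reflexivity|]; exists u; split; [exact (generic_cond hG Gu)|].
    exists c; repeat split; auto; exists q; split; [exact (generic_cond hG Gq)|auto].
  - intros (w & s & Hw & (Ss & p & Hp & b & Hb & -> & u & Hu & c & Sc & Huc & L1 &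
      q & Hq & L2 & Dq) & ->).
    apply in_prod_pair in Hw; destruct Hw as [Gp Hb'].
    exists b, (val G s); split; [|auto]; apply in_val; exists u, c; split; [exact Huc|].
    split; [exact (generic_up hG Gp Hu L1)|].
    rewrite <- (val_chk b GE) at 1; rewrite <- val_pairname by exact GE; symmetry.
    apply (V1 G hG); [auto|apply NK, KN; exists b, s; auto|].
    exists q; split; [exact (generic_up hG Gp Hq L2)|exact Dq]. }
apply (V2 G H hG hGH x y Sx Sy) in Exy; destruct Exy as (w & Hw & Dw).
apply in_prod in Hw; destruct Hw as (p & b & Gp & Hb & ->); exists p, b.
repeat split; auto; intros G' H' hG' hGH' Gp' Hb'.
apply (V2 G' H' hG' hGH' x y Sx Sy); exists ⟨p, b⟩; rewrite in_prod_pair; auto.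
Qed.

(** * Building the second generic filter *)

(** The usual descending sequence, for arbitrary predicates, in [M] or not. Density is a premise for
    each [n] separately, so a list may include predicates that are not dense. *)
Lemma rasiowa_sikorski (Q : notion) (F : nat -> V -> Prop) p0 : M_notion Q -> p0 ∈ cond Q ->
  exists H, is_filter Q H /\ p0 ∈ H /\ forall n,
    (forall p, p ∈ cond Q -> exists q, q ∈ cond Q /\ le Q q p /\ F n q) ->
    exists p, p ∈ H /\ F n p.
Proof.
intros hQ Hp0.
set (good := fun n p q => q ∈ cond Q /\ le Q q p /\
  ((forall p, p ∈ cond Q -> exists q, q ∈ cond Q /\ le Q q p /\ F n q) -> F n q)).
assert (Hgood : forall n p, p ∈ cond Q -> exists q, good n p q).
{ intros n p Hp; destruct (classic (forall p, p ∈ cond Q ->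
    exists q, q ∈ cond Q /\ le Q q p /\ F n q)) as [D|D].
  - destruct (D p Hp) as (q & H1 & H2 & H3); exists q; repeat split; auto.
  - exists p; repeat split; [exact Hp|exact (le_refl hQ Hp)|contradiction]. }
set (s := fix s n := match n with O => p0 | S n => epsilon (inhabits empty) (good n (s n)) end).
assert (Hs : forall n, s n ∈ cond Q /\ good n (s n) (s (S n))).
{ assert (step : forall n, s n ∈ cond Q -> good n (s n) (s (S n)))
    by (intros n Hn; exact (epsilon_spec (inhabits empty) _ (Hgood n (s n) Hn))).
  induction n as [|n [_ IH]]; split; auto.
  - apply IH.
  - apply step, IH. }
assert (mono : forall m n, m <= n -> le Q (s n) (s m)).
{ intros m n; induction 1 as [|n _ IH]; [exact (le_refl hQ (proj1 (Hs m)))|].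
  exact (le_trans hQ (proj1 (proj2 (proj2 (Hs n)))) IH). }
set (H := {{ q | q ∈ cond Q /\ exists n, le Q (s n) q }}).
assert (KH : forall q, q ∈ H <-> q ∈ cond Q /\ exists n, le Q (s n) q).
{ apply in_compr; apply small_sub with (2 := small_mem (cond Q)); tauto. }
assert (sH : forall n, s n ∈ H)
  by (intro n; apply KH; split; [apply Hs|exists n; exact (le_refl hQ (proj1 (Hs n)))]).
exists H; split; [split; [|split; [|split]]|split].
- intros q Hq; apply KH, Hq.
- exists (s 0); apply sH.
- intros p q Hp Hq L; apply KH in Hp; destruct Hp as (_ & n & Hn); apply KH.
  split; [exact Hq|]; exists n; exact (le_trans hQ Hn L).
- intros p q Hp Hq; apply KH in Hp, Hq; destruct Hp as (_ & m & Hm), Hq as (_ & n & Hn).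
  exists (s (m + n)); split; [apply sH|].
  split; [apply (le_trans hQ (mono m (m + n) ltac:(lia)) Hm)|].
  apply (le_trans hQ (mono n (m + n) ltac:(lia)) Hn).
- exact (sH 0).
- intros n D; exists (s (S n)); split; [apply sH|]; exact (proj2 (proj2 (proj2 (Hs n))) D).
Qed.

Lemma forces_eq_refl (Q : notion) p t : M_notion Q -> forces_eq Q p t t.
Proof.
intro hQ; revert p; induction (subname_wf t) as [t _ IH]; intro p; constructor;
  intros p1 s1 H q Hq L; exists q; (split; [exact Hq|]);
  (split; [exact (le_refl hQ Hq)|]); intro L1; exists p1, s1;
  (split; [exact H|]; split; [exact L1|]; apply IH; exists p1; exact H).
Qed.

Lemma forces_eq_sym Q p s t : forces_eq Q p s t -> forces_eq Q p t s.
Proof.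
revert p t; induction (subname_wf s) as [s _ IH]; intros p t F.
inversion_clear F as [? ? ? H1 H2]; constructor.
- intros p2 s2 K q Hq L; destruct (H2 p2 s2 K q Hq L) as (r & Hr & L1 & C).
  exists r; repeat split; auto; intro L2; destruct (C L2) as (p1 & s1 & K1 & L3 & E).
  exists p1, s1; split; [exact K1|]; split; [exact L3|]; apply IH; [exists p1|]; assumption.
- intros p1 s1 K q Hq L; destruct (H1 p1 s1 K q Hq L) as (r & Hr & L1 & C).
  exists r; repeat split; auto; intro L2; destruct (C L2) as (p2 & s2 & K2 & L3 & E).
  exists p2, s2; split; [exact K2|]; split; [exact L3|]; apply IH; [exists p1|]; assumption.
Qed.

Lemma name_pair Q t p s : name Q t -> ⟨p, s⟩ ∈ t -> p ∈ cond Q /\ name Q s.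
Proof.
intros [t' Ht] H; destruct (Ht _ H) as (p' & s' & Hp & Hs & E).
apply pair_inj in E; destruct E as [-> ->]; auto.
Qed.

(** The third hypothesis says that [H] meets the dense sets occurring in the definition of
    [forces_eq], for names in the class [W]. *)
Lemma forces_eq_val (Q : notion) H (W : V -> Prop) : is_filter Q H ->
  (forall t p s, W t -> ⟨p, s⟩ ∈ t -> W s) ->
  (forall p p1 s1 t, p ∈ H -> p1 ∈ H -> W s1 -> W t ->
    (forall q, q ∈ cond Q -> le Q q p -> le Q q p1 -> exists r, r ∈ cond Q /\ le Q r q /\
      exists p2 s2, ⟨p2, s2⟩ ∈ t /\ le Q r p2 /\ forces_eq Q r s1 s2) ->
    exists r, r ∈ H /\ exists p2 s2, ⟨p2, s2⟩ ∈ t /\ le Q r p2 /\ forces_eq Q r s1 s2) ->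
  (forall p q r, le Q p q -> le Q q r -> le Q p r) ->
  forall s t p, name Q s -> name Q t -> W s -> W t -> p ∈ H -> forces_eq Q p s t ->
    val H s = val H t.
Proof.
intros (_ & _ & Hup & _) WT Hgen Lt.
intro s; induction (subname_wf s) as [s _ IH]; intros t p Ns Nt Ws Wt Hp F.
inversion_clear F as [? ? ? H1 H2]; apply subset_antisym; intros z Hz; apply in_val in Hz.
- destruct Hz as (p1 & s1 & K & Hp1 & ->); assert (Ws1 := WT _ _ _ Ws K).
  destruct (Hgen p p1 s1 t Hp Hp1 Ws1 Wt) as (r & Hr & p2 & s2 & K2 & L & E).
  + intros q Hq L1 L2; destruct (H1 p1 s1 K q Hq L1) as (r & Hr & L & C).
    exists r; repeat split; auto; exact (C (Lt _ _ _ L L2)).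
  + destruct (name_pair Nt K2) as [Hp2 Ns2].
    rewrite (IH s1 (ex_intro _ p1 K) s2 r (proj2 (name_pair Ns K)) Ns2 Ws1 (WT _ _ _ Wt K2) Hr E).
    apply in_val; exists p2, s2; repeat split; auto; exact (Hup r p2 Hr Hp2 L).
- destruct Hz as (p2 & s2 & K & Hp2 & ->); assert (Ws2 := WT _ _ _ Wt K).
  destruct (Hgen p p2 s2 s Hp Hp2 Ws2 Ws) as (r & Hr & p1 & s1 & K1 & L & E).
  + intros q Hq L1 L2; destruct (H2 p2 s2 K q Hq L1) as (r & Hr & L & C).
    destruct (C (Lt _ _ _ L L2)) as (p1 & s1 & K1 & L3 & E).
    exists r; repeat split; auto; exists p1, s1; auto using forces_eq_sym.
  + destruct (name_pair Ns K1) as [Hp1 Ns1].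
    rewrite <- (IH s1 (ex_intro _ p1 K1) s2 r Ns1 (proj2 (name_pair Nt K)) (WT _ _ _ Ws K1) Ws2 Hr
      (forces_eq_sym E)).
    apply in_val; exists p1, s1; repeat split; auto; exact (Hup r p1 Hr Hp1 L).
Qed.

Lemma generic_extension G r : generic M cohen G -> r ∈ I -> exists H,
  is_filter inj_omega H /\ r ∈ H /\ generic M cohen_inj (prod G H) /\
  forall s t p, M s -> M t -> name inj_omega (val G s) -> name inj_omega (val G t) ->
    p ∈ H -> forces_eq inj_omega p (val G s) (val G t) -> val H (val G s) = val H (val G t).
Proof.
intros hG Hr.
assert (hI := M_inj_omega).
(* The section over [G] of a dense subset of the product; it is dense in the second factor by
   genericity of [G]. *)
set (F1 := fun d q => exists p, p ∈ G /\ ⟨p, q⟩ ∈ enum d).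
set (good := fun p p1 s1 t q => p ⊆ q /\ p1 ⊆ q /\
  exists p2 s2, ⟨p2, s2⟩ ∈ t /\ le inj_omega q p2 /\ forces_eq inj_omega q s1 s2).
(* The number [d] codes two conditions and two names. The second alternative, having no common
   extension with both conditions, turns density below the two conditions into density
   everywhere. *)
set (F2 := fun d q => forall i j k l, d = to_nat (to_nat (i, j), to_nat (k, l)) ->
  good (enum i) (enum j) (val G (enum k)) (val G (enum l)) q \/
  ~ exists u, u ∈ I /\ q ⊆ u /\ enum i ⊆ u /\ enum j ⊆ u).
destruct (rasiowa_sikorski (fun n => if Nat.even n then F1 (Nat.div2 n) else F2 (Nat.div2 n)) hI Hr)
  as (H & HH & Hr' & KH).
assert (K1 : forall d, (forall p, p ∈ I -> exists q, q ∈ I /\ p ⊆ q /\ F1 d q) ->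
  exists q, q ∈ H /\ F1 d q).
{ intros d Hd; specialize (KH (2 * d)).
  rewrite Nat.even_even, Nat.div2_double in KH; exact (KH Hd). }
assert (K2 : forall d, (forall p, p ∈ I -> exists q, q ∈ I /\ p ⊆ q /\ F2 d q) ->
  exists q, q ∈ H /\ F2 d q).
{ intros d Hd; specialize (KH (S (2 * d))).
  rewrite Nat.div2_succ_double, <- Nat.negb_odd, <- Nat.add_1_r, Nat.odd_odd in KH.
  exact (KH Hd). }
clear KH; exists H; split; [exact HH|]; split; [exact Hr'|].
assert (HI : forall q, q ∈ H -> q ∈ I) by apply HH.
assert (Hc : forall p q, p ∈ H -> q ∈ H -> exists u, u ∈ H /\ p ⊆ u /\ q ⊆ u) by apply HH.
split.
- split; [exact (filter_prod (proj1 hG) HH)|]; intros D MD [D1 D2].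
  destruct (proj2 enumeration_spec D MD) as [d ->].
  destruct (K1 d) as (q & Hq & p & Gp & HD).
  + intros b Hb.
    destruct (generic_meets M_cohen hG (P := fun p => exists q, q ∈ I /\ b ⊆ q /\ ⟨p, q⟩ ∈ enum d))
      as (p & Gp & q & Hq & L & K).
    * assert (MI := M_I); assert (Mb := M_trans MI Hb).
      repeat first [apply dterm_pair|dstep].
    * intros p Hp; destruct (D2 ⟨p, b⟩) as (w & Hw & L); [apply in_prod_pair; auto|].
      assert (W := D1 w Hw); apply in_prod in W; destruct W as (p' & q & Hp' & Hq & ->).
      apply le_cohen_inj in L; exists p'; repeat split; try tauto; exists q; tauto.
    * exists q; repeat split; auto; exists p; auto.
  + exists ⟨p, q⟩; rewrite in_prod_pair; auto.
- intros s t p Ms Mt Ns Nt Hp F.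
  apply (forces_eq_val (W := fun x => exists y, M y /\ x = val G y) HH) with (p := p); eauto.
  + intros x q y (x' & Mx & ->) Hy; apply in_val in Hy; destruct Hy as (u & z & Hz & _ & E).
    destruct (val_pair_snd E) as (k & k' & d & y' & H1 & H2 & ->); exists y'.
    split; [|reflexivity].
    exact (M_snd (M_trans (M_snd (M_trans (M_snd (M_trans Mx Hz)) H1)) H2)).
  + intros q q1 s1 x Hq Hq1 (s1' & Ms1 & ->) (x' & Mx & ->) Hd.
    destruct (proj2 enumeration_spec q (M_trans M_I (HI q Hq))) as [i ->].
    destruct (proj2 enumeration_spec q1 (M_trans M_I (HI q1 Hq1))) as [j ->].
    destruct (proj2 enumeration_spec s1' Ms1) as [k ->].
    destruct (proj2 enumeration_spec x' Mx) as [l ->].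
    destruct (K2 (to_nat (to_nat (i, j), to_nat (k, l)))) as (v & Hv & Fv).
    * intros b Hb.
      destruct (classic (exists u, u ∈ I /\ b ⊆ u /\ enum i ⊆ u /\ enum j ⊆ u))
        as [(u & Hu & L1 & L2 & L3)|N].
      -- destruct (Hd u Hu L2 L3) as (v & Hv & L4 & K); exists v; split; [exact Hv|].
         split; [intros z Hz; exact (L4 z (L1 z Hz))|].
         intros i' j' k' l' E; left.
         apply to_nat_inj, pair_equal_spec in E; destruct E as [E E'].
         apply to_nat_inj, pair_equal_spec in E, E'.
         destruct E as [<- <-], E' as [<- <-]; split; [intros z Hz; exact (L4 z (L2 z Hz))|].
         split; [intros z Hz; exact (L4 z (L3 z Hz))|exact K].
      -- exists b; split; [exact Hb|]; split; [intros z Hz; exact Hz|].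
         intros i' j' k' l' E; right.
         apply to_nat_inj, pair_equal_spec in E; destruct E as [E E'].
         apply to_nat_inj, pair_equal_spec in E; destruct E as [<- <-]; exact N.
    * destruct (Fv i j k l eq_refl) as [(_ & _ & K)|N]; [exists v; auto|].
      exfalso; apply N; destruct (Hc (enum i) (enum j) Hq Hq1) as (u & Hu & L1 & L2).
      destruct (Hc u v Hu Hv) as (w & Hw & L3 & L4); exists w; split; [auto|].
      repeat split; [exact L4| |]; intros z Hz; apply L3; auto.
  + intros p1 q u L1 L2 z Hz; exact (L1 z (L2 z Hz)).
Qed.

(** * Genericity of the Cohen reals *)

(** Supplies rows and columns on which a condition says nothing. *)
Lemma bounded_cond p : finite p -> exists N, forall i j b,
  ⟨⟨num i, num j⟩, b⟩ ∈ p -> i < N /\ j < N.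
Proof.
intros [l Hl].
enough (E : exists N, forall i j b, In ⟨⟨num i, num j⟩, b⟩ l -> i < N /\ j < N)
  by (destruct E as [N HN]; exists N; intros i j b H; exact (HN i j b (Hl _ H))).
clear p Hl; induction l as [|a l [N HN]]; [exists 0; intros i j b []|].
destruct (classic (exists i j b, a = ⟨⟨num i, num j⟩, b⟩)) as [(i & j & b & ->)|Na].
- exists (N + S i + S j); intros i' j' b' [E|E].
  + apply pair_inj in E; destruct E as [E _]; apply pair_inj in E; destruct E as [E1 E2].
    apply num_inj in E1, E2; lia.
  + specialize (HN i' j' b' E); lia.
- exists N; intros i j b [E|E]; [destruct Na; eauto|exact (HN i j b E)].
Qed.

Lemma cond_subset p q : p ∈ P -> q ⊆ p -> q ∈ P.
Proof.
intros Hp H; apply in_P in Hp; destruct Hp as ([l Hl] & H2 & H3); apply in_P.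
split; [exists l; auto|]; split; [auto|]; intros a b b' K K'; eauto.
Qed.

Lemma cond_cup p q : p ∈ P -> q ∈ P ->
  (forall a b b', ⟨a, b⟩ ∈ p -> ⟨a, b'⟩ ∈ q -> b = b') -> cup p q ∈ P.
Proof.
intros Hp Hq H; apply in_P in Hp, Hq; destruct Hp as (P1 & P2 & P3), Hq as (Q1 & Q2 & Q3).
apply in_P; split; [apply finite_cup; assumption|]; split.
- intros z Hz; apply in_cup in Hz; destruct Hz; auto.
- intros a b b' K K'; apply in_cup in K, K'; destruct K, K'; eauto; symmetry; eauto.
Qed.

Lemma cup_l x y : x ⊆ cup x y.
Proof. intros z Hz; apply in_cup; auto. Qed.

Lemma cup_r x y : y ⊆ cup x y.
Proof. intros z Hz; apply in_cup; auto. Qed.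

Definition cell (x : nat * nat * nat) : V :=
  let '(i, m, b) := x in ⟨⟨num i, num m⟩, num b⟩.

(** Finitely many new bits, consistent with each other and off the domain of [p], can be added at
    once. The density arguments for containing, omitting and separating are instances. *)
Lemma cond_cells p (l : list (nat * nat * nat)) : p ∈ P ->
  (forall i m b, In (i, m, b) l -> b < 2 /\ forall b', ~ ⟨⟨num i, num m⟩, b'⟩ ∈ p) ->
  (forall i m b b', In (i, m, b) l -> In (i, m, b') l -> b = b') ->
  exists q, q ∈ P /\ p ⊆ q /\ forall x, In x l -> cell x ∈ q.
Proof.
intros Hp H1 H2.
destruct (set_of_family (fun x : {x | In x l} => cell (proj1_sig x))) as [d Kd].
assert (C : forall z, z ∈ d <-> exists i m b, In (i, m, b) l /\ z = ⟨⟨num i, num m⟩, num b⟩).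
{ intro z; rewrite Kd; split.
  - intros [[[[i m] b] Hx] ->]; exists i, m, b; auto.
  - intros (i & m & b & Hx & ->); exists (exist _ (i, m, b) Hx); reflexivity. }
exists (cup p d); split; [apply cond_cup; [exact Hp| |]|split; [apply cup_l|]].
- apply in_P; split; [|split].
  + exists (map cell l); intros z Hz; apply C in Hz; destruct Hz as (i & m & b & Hx & ->).
    apply in_map_iff; exists (i, m, b); auto.
  + intros z Hz; apply C in Hz; destruct Hz as (i & m & b & Hx & ->).
    exists i, m, (num b); split; [reflexivity|]; apply in_num; exists b.
    split; [apply (H1 i m b Hx)|reflexivity].
  + intros a e e' Hd Hd'; apply C in Hd, Hd'.
    destruct Hd as (i & m & b & Hx & E), Hd' as (i' & m' & b' & Hx' & E').
    apply pair_inj in E, E'; destruct E as [-> ->], E' as [E ->].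
    apply pair_inj in E; destruct E as [E1 E2]; apply num_inj in E1, E2; subst.
    rewrite (H2 _ _ _ _ Hx Hx'); reflexivity.
- intros a e e' Hd Hd'; apply C in Hd'; destruct Hd' as (i & m & b & Hx & E).
  apply pair_inj in E; destruct E as [-> ->]; destruct (proj2 (H1 i m b Hx) e Hd).
- intros [[i m] b] Hx; apply cup_r, C; eauto.
Qed.

Section CohenReals.

Variable G : V.
Variable hG : generic M cohen G.

Lemma not_in_real i m p : p ∈ G -> ⟨⟨num i, num m⟩, num 0⟩ ∈ p -> ~ num m ∈ real G (num i).
Proof.
intros Gp Hp H; apply in_real in H; destruct H as (_ & q & Gq & Hq).
destruct (generic_common hG Gp Gq) as (r & Gr & L1 & L2).
assert (K := generic_cond hG Gr); apply in_P in K; destruct K as (_ & _ & K).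
assert (E := K _ _ _ (L1 _ Hp) (L2 _ Hq)); apply num_inj in E; discriminate.
Qed.

Ltac dcond :=
  assert (MO := M_omega); assert (MN := M_num); repeat first [apply dterm_pair|dstep].

Lemma some_real_contains n : exists i, num n ∈ real G (num i).
Proof.
destruct (generic_meets M_cohen hG (P := fun p => exists i, i ∈ omega /\
    ⟨⟨i, num n⟩, num 1⟩ ∈ p)) as (p & Gp & i & Hi & K).
- dcond.
- intros p Hp; destruct (bounded_cond (proj1 (proj1 (in_P p) Hp))) as [N HN].
  destruct (@cond_cells p ((N, n, 1) :: nil) Hp) as (q & Hq & L & K).
  + intros i m b [E|[]]; injection E as <- <- <-; split; [lia|]; intros d Hd.
    apply HN in Hd; lia.
  + intros i m b b' [E|[]] [E'|[]]; congruence.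
  + exists q; split; [exact Hq|]; split; [exact L|]; exists (num N).
    split; [apply in_omega; eauto|]; apply (K (N, n, 1)); left; reflexivity.
- apply in_omega in Hi; destruct Hi as [j ->]; exists j; apply in_real; split; [|eauto].
  apply in_omega; eauto.
Qed.

Lemma reals_omit k : exists n, forall i, i < k -> ~ num n ∈ real G (num i).
Proof.
destruct (generic_meets M_cohen hG (P := fun p => exists n, n ∈ omega /\ forall i, i ∈ num k ->
    ⟨⟨i, n⟩, num 0⟩ ∈ p)) as (p & Gp & n & Hn & K).
- dcond.
- intros p Hp; destruct (bounded_cond (proj1 (proj1 (in_P p) Hp))) as [N HN].
  (* Column [N] is untouched by [p], so its first [k] entries can all be set to 0. *)
  destruct (@cond_cells p (map (fun i => (i, N, 0)) (seq 0 k)) Hp) as (q & Hq & L & K).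
  + intros i m b E; apply in_map_iff in E; destruct E as (i' & E & _).
    injection E as <- <- <-; split; [lia|]; intros d Hd; apply HN in Hd; lia.
  + intros i m b b' E E'; apply in_map_iff in E, E'.
    destruct E as (i1 & E & _), E' as (i2 & E' & _); congruence.
  + exists q; split; [exact Hq|]; split; [exact L|]; exists (num N).
    split; [apply in_omega; eauto|]; intros i Hi; apply in_num in Hi.
    destruct Hi as (j & Hj & ->); apply (K (j, N, 0)), in_map_iff; exists j.
    split; [reflexivity|apply in_seq; lia].
- apply in_omega in Hn; destruct Hn as [m ->]; exists m; intros i Hi.
  apply (not_in_real Gp), K, in_num; eauto.
Qed.

Lemma real_injective i j : i <> j -> real G (num i) <> real G (num j).
Proof.
intros Hij E.
destruct (generic_meets M_cohen hG (P := fun p => exists m, m ∈ omega /\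
    ⟨⟨num i, m⟩, num 1⟩ ∈ p /\ ⟨⟨num j, m⟩, num 0⟩ ∈ p)) as (p & Gp & m & Hm & K1 & K2).
- dcond.
- intros p Hp; destruct (bounded_cond (proj1 (proj1 (in_P p) Hp))) as [N HN].
  destruct (@cond_cells p ((i, N, 1) :: (j, N, 0) :: nil) Hp) as (q & Hq & L & K).
  + intros i' m b [E'|[E'|[]]]; injection E' as <- <- <-; (split; [lia|]); intros d Hd;
      apply HN in Hd; lia.
  + intros i' m b b' [E1|[E1|[]]] [E2|[E2|[]]]; congruence.
  + exists q; split; [exact Hq|]; split; [exact L|]; exists (num N).
    split; [apply in_omega; eauto|].
    split; [apply (K (i, N, 1))|apply (K (j, N, 0))]; simpl; auto.
- assert (H : m ∈ real G (num i)) by (apply in_real; eauto).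
  apply in_omega in Hm; destruct Hm as [m' ->]; rewrite E in H.
  exact (not_in_real Gp K2 H).
Qed.

(** Given [q], take a row [j] beyond [p] and [q] and copy row [i] of [p] into it. Row [j] of [p] is
    empty, so the swapped condition has an empty row [i] and lies in the union of [p] and the
    extended [q]. *)
Lemma swap_generic p i : p ∈ G -> exists j, i < j /\ act_cond (swap i j) p ∈ G.
Proof.
intro Gp; assert (Hp := generic_cond hG Gp).
destruct (generic_meets M_cohen hG (P := fun q => exists j, j ∈ omega /\ num i ∈ j /\
    (forall m, m ∈ omega -> forall b, b ∈ num 2 -> ~ ⟨⟨j, m⟩, b⟩ ∈ p) /\
    (forall m, m ∈ omega -> forall b, b ∈ num 2 -> ⟨⟨num i, m⟩, b⟩ ∈ p -> ⟨⟨j, m⟩, b⟩ ∈ q)))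
  as (q & Gq & j & Hj & Hij & K1 & K2).
- assert (Mp := M_trans M_P Hp); dcond.
- intros q Hq; destruct (bounded_cond (proj1 (proj1 (in_P p) Hp))) as [N HN].
  destruct (bounded_cond (proj1 (proj1 (in_P q) Hq))) as [N' HN'].
  set (j := S i + N + N').
  (* Row [j] of the swapped condition, that is, the copy of row [i] of [p]. *)
  set (r := {{ z | z ∈ act_cond (swap i j) p /\ exists m b, z = ⟨⟨num j, m⟩, b⟩ }}).
  assert (Kr : forall z, z ∈ r <-> z ∈ act_cond (swap i j) p /\ exists m b, z = ⟨⟨num j, m⟩, b⟩).
  { apply in_compr; apply small_sub with (2 := small_mem (act_cond (swap i j) p)); tauto. }
  exists (cup q r); split; [apply cond_cup|split; [apply cup_l|]].
  + exact Hq.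
  + apply cond_subset with (p := act_cond (swap i j) p); [|intros z Hz; apply Kr, Hz].
    apply act_cond_P; [apply swap_inj|exact Hp].
  + intros a b b' H H'; apply Kr in H'; destruct H' as (_ & m & b0 & E).
    apply pair_inj in E; destruct E as [-> _].
    destruct (in_P_elem Hq H) as (i' & m' & E & _); apply pair_inj in E.
    destruct E as [E ->]; rewrite E in H; apply num_inj in E; apply HN' in H; lia.
  + exists (num j); split; [apply in_omega; eauto|].
    split; [apply in_num; exists i; split; [lia|reflexivity]|]; split.
    * intros m Hm b _ H; apply in_omega in Hm; destruct Hm as [m' ->]; apply HN in H; lia.
    * intros m Hm b _ H; apply cup_r, Kr; split; [|eauto].
      apply in_omega in Hm; destruct Hm as [m' ->].
      apply in_act_cond; exists i, m', b; rewrite swap_l; auto.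
- apply in_omega in Hj; destruct Hj as [j' ->]; exists j'.
  apply in_num in Hij; destruct Hij as (i' & Hij & E); apply num_inj in E; subst i'.
  split; [exact Hij|]; destruct (generic_common hG Gp Gq) as (r & Gr & L1 & L2).
  apply (generic_up hG Gr); [apply act_cond_P; [apply swap_inj|exact Hp]|].
  intros z Hz; apply in_act_cond in Hz; destruct Hz as (i1 & m & b & H & ->).
  assert (Hm : num m ∈ omega) by (apply in_omega; eauto).
  destruct (in_P_elem Hp H) as (_ & _ & _ & Hb).
  destruct (Nat.eq_dec i1 i) as [->|E1]; [rewrite swap_l; apply L2; auto|].
  destruct (Nat.eq_dec i1 j') as [->|E2]; [destruct (K1 _ Hm _ Hb H)|].
  rewrite swap_other by assumption; apply L1, H.
Qed.

End CohenReals.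

(** * Genericity after swapping two rows *)

Lemma filter_act f G : in_group f -> is_filter cohen G -> is_filter cohen (act_filter f G).
Proof.
intros Hf (G1 & (g & Gg) & G3 & G4); assert (Inj := group_injective Hf).
destruct (group_bij Hf) as (h & Hfh & Hhf).
assert (Injh : forall m n, h m = h n -> m = n)
  by (intros m n E; rewrite <- (Hfh m), E; apply Hfh).
assert (mono : forall f p q, p ⊆ q -> act_cond f p ⊆ act_cond f q).
{ intros k p q L z Hz; apply in_act_cond in Hz; destruct Hz as (i & j & b & H & ->).
  apply in_act_cond; exists i, j, b; auto. }
split; [|split; [|split]].
- intros q Hq; apply in_act_filter in Hq; destruct Hq as (p & Gp & ->).
  apply act_cond_P; auto.
- exists (act_cond f g); apply in_act_filter; eauto.
- intros x q Hx Hq L; apply in_act_filter in Hx; destruct Hx as (p & Gp & ->).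
  apply in_act_filter; exists (act_cond h q); split; [|symmetry; apply act_cond_inv; auto].
  apply (G3 p); [exact Gp|apply act_cond_P; auto|].
  unfold le; simpl; unfold rev_incl; rewrite <- (act_cond_inv Hhf (G1 _ Gp)); auto.
- intros x y Hx Hy; apply in_act_filter in Hx, Hy.
  destruct Hx as (p & Gp & ->), Hy as (q & Gq & ->).
  destruct (G4 p q Gp Gq) as (r & Gr & L1 & L2); exists (act_cond f r).
  split; [apply in_act_filter; eauto|split; apply mono; assumption].
Qed.

(** A dense set [D] of [M] is pulled back along the swap of the first coordinate. The preimage [D']
    is dense, and it lies in [M] because a transposition is definable from [i] and [j]. *)
Lemma generic_swap i j G H : i < j -> is_filter cohen G -> is_filter inj_omega H ->
  generic M cohen_inj (prod G H) -> generic M cohen_inj (prod (act_filter (swap i j) G) H).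
Proof.
intros Hij HG HH HGH; assert (Hs := group_gen Hij); assert (Sinj := @swap_inj i j).
assert (MP := M_P); assert (MI := M_I).
split; [apply filter_prod; [apply filter_act|]; assumption|]; intros D MD [D1 D2].
(* The transposition written as a formula on numerals; [swap] itself is a function of the
   metatheory. *)
set (sw := fun a a' => (a = num i /\ a' = num j) \/ (a = num j /\ a' = num i) \/
  (a <> num i /\ a <> num j /\ a' = a)).
assert (Ksw : forall n a, sw (num n) a <-> a = num (swap i j n)).
{ intros n a; unfold sw; split.
  - intros [[E ->]|[[E ->]|(E1 & E2 & ->)]].
    + apply num_inj in E; subst; rewrite swap_l; reflexivity.
    + apply num_inj in E; subst; rewrite swap_r; reflexivity.
    + rewrite swap_other; congruence.
  - intros ->; destruct (Nat.eq_dec n i) as [->|E1]; [rewrite swap_l; auto|].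
    destruct (Nat.eq_dec n j) as [->|E2]; [rewrite swap_r; auto|].
    rewrite swap_other by assumption; right; right.
    repeat split; intro E; apply num_inj in E; auto. }
set (R := fun p q => forall a, a ∈ omega -> forall a', a' ∈ omega -> forall m, m ∈ omega ->
  forall b, b ∈ num 2 -> sw a a' -> (⟨⟨a, m⟩, b⟩ ∈ p <-> ⟨⟨a', m⟩, b⟩ ∈ q)).
assert (KR : forall p q, p ∈ P -> q ∈ P -> (R p q <-> q = act_cond (swap i j) p)).
{ intros p q Hp Hq; split.
  - intro HR; apply set_ext; intro z; split.
    + intro Hz; destruct (proj1 (proj2 (proj1 (in_P q) Hq)) z Hz) as (i' & m & b & -> & Hb).
      apply in_act_cond; exists (swap i j i'), m, b; rewrite swap_invol; split; [|reflexivity].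
      apply (HR (num (swap i j i'))) with (a' := num i'); try (apply in_omega; eauto);
        [exact Hb|apply Ksw; rewrite swap_invol; reflexivity|exact Hz].
    + intro Hz; apply in_act_cond in Hz; destruct Hz as (i' & m & b & Hz & ->).
      apply (HR (num i')); try (apply in_omega; eauto); [|apply Ksw; reflexivity|exact Hz].
      destruct (in_P_elem Hp Hz) as (_ & _ & _ & Hb); exact Hb.
  - intros -> a Ha a' Ha' m Hm b Hb Hsw; apply in_omega in Ha, Hm.
    destruct Ha as [n ->], Hm as [k ->]; apply Ksw in Hsw; subst a'.
    symmetry; apply in_act_bit; exact Sinj. }
destruct (M_sep (P := fun w => exists p, p ∈ P /\ exists b, b ∈ I /\ w = ⟨p, b⟩ /\
    exists q, q ∈ P /\ R p q /\ ⟨q, b⟩ ∈ D)) with (x := prod P I) as (D' & MD' & KD').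
- assert (MO := M_omega); assert (MN := M_num); unfold R, sw.
  repeat first [apply dterm_pair|apply def_iff|dstep].
- apply M_prod; assumption.
- destruct (proj2 HGH D' MD') as (w & Hw & GHw).
  + split; [intros w Hw; apply KD', Hw|].
    intros w Hw; apply in_prod in Hw; destruct Hw as (p & b & Hp & Hb & ->).
    destruct (D2 ⟨act_cond (swap i j) p, b⟩) as (w & Hw & L).
    { apply in_prod_pair; split; [apply act_cond_P; auto|exact Hb]. }
    assert (W := D1 w Hw); apply in_prod in W; destruct W as (q & d & Hq & Hd & ->).
    apply le_cohen_inj in L; destruct L as [L1 L2].
    assert (Hq' : act_cond (swap i j) q ∈ P) by (apply act_cond_P; auto).
    exists ⟨act_cond (swap i j) q, d⟩; split.
    * apply KD'; split; [apply in_prod_pair; auto|].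
      exists (act_cond (swap i j) q); split; [exact Hq'|]; exists d; split; [exact Hd|].
      split; [reflexivity|]; exists q; split; [exact Hq|]; split; [|exact Hw].
      apply KR; auto; symmetry; apply act_cond_inv; [apply swap_invol|exact Hq].
    * apply le_cohen_inj; split; [|exact L2].
      rewrite <- (act_cond_inv (swap_invol i j) Hp); intros z Hz.
      apply in_act_cond in Hz; destruct Hz as (i' & m & b' & Hz & ->).
      apply in_act_cond; exists i', m, b'; auto.
  + apply KD' in Hw; destruct Hw as (_ & p & Hp & b & Hb & -> & q & Hq & HR & HD).
    apply in_prod_pair in GHw; apply KR in HR; [|assumption|assumption]; subst q.
    exists ⟨act_cond (swap i j) p, b⟩; split; [exact HD|]; apply in_prod_pair.
    split; [apply in_act_filter; exists p|]; tauto.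
Qed.

(** * Deciding the value of the generic injection at 0 *)

Lemma start_I n : start (num n) ∈ I.
Proof.
assert (K : forall z, z ∈ start (num n) -> z = ⟨empty, num n⟩)
  by (intros z Hz; apply in_upair in Hz; tauto).
simpl; apply in_Inj; split; [|split; [|split]].
- exists (⟨empty, num n⟩ :: nil); intros z Hz; left; symmetry; auto.
- intros z Hz; rewrite (K z Hz); apply in_prod_pair.
  split; apply in_omega; [exists 0; reflexivity|eauto].
- intros a b b' H H'; apply K in H, H'; apply pair_inj in H, H'; destruct H, H'; congruence.
- intros a a' b H H'; apply K in H, H'; apply pair_inj in H, H'; destruct H, H'; congruence.
Qed.

Lemma in_start n z : z ∈ start n <-> z = ⟨empty, n⟩.
Proof. unfold start; rewrite in_upair; tauto. Qed.

(** If [q] leaves 0 free, [n] is taken above all values of [q], which keeps the extension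
    one-to-one. *)
Lemma extend_start q : q ∈ I -> exists r n, r ∈ I /\ q ⊆ r /\ start (num n) ⊆ r.
Proof.
intro Hq; destruct (classic (exists n, ⟨empty, num n⟩ ∈ q)) as [[n Hn]|N].
{ exists q, n; split; [exact Hq|]; split; [intros z Hz; exact Hz|].
  intros z Hz; apply in_start in Hz; subst z; exact Hn. }
assert (K := Hq); simpl in K; apply in_Inj in K; destruct K as ([l Hl] & H2 & H3 & H4).
assert (B : exists N, forall a n, In ⟨a, num n⟩ l -> n < N).
{ clear Hl; induction l as [|x l [B HB]]; [exists 0; intros a n []|].
  destruct (classic (exists a n, x = ⟨a, num n⟩)) as [(a & n & ->)|Nx].
  - exists (B + S n); intros a' n' [E|E].
    + apply pair_inj in E; destruct E as [_ E]; apply num_inj in E; lia.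
    + specialize (HB a' n' E); lia.
  - exists B; intros a n [E|E]; [destruct Nx; eauto|eauto]. }
destruct B as [n Hn]; exists (cup q (start (num n))), n.
assert (Hs := start_I n); simpl in Hs; apply in_Inj in Hs; destruct Hs as (S1 & S2 & S3 & S4).
split; [|split; [apply cup_l|apply cup_r]]; simpl; apply in_Inj.
split; [apply finite_cup; [exists l|]; assumption|]; split; [|split].
- intros z Hz; apply in_cup in Hz; destruct Hz; auto.
- assert (D : forall a b, ⟨a, b⟩ ∈ q -> ~ a = empty).
  { intros a b H ->; apply N; assert (H' := H2 _ H); apply in_prod_pair in H'.
    destruct H' as [_ H']; apply in_omega in H'; destruct H' as [m ->]; eauto. }
  intros a b b' H H'; apply in_cup in H, H'; rewrite in_start in H, H'.
  destruct H as [H|H], H' as [H'|H'].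
  + eauto.
  + apply pair_inj in H'; destruct H' as [-> _]; destruct (D _ _ H eq_refl).
  + apply pair_inj in H; destruct H as [-> _]; destruct (D _ _ H' eq_refl).
  + apply pair_inj in H, H'; destruct H, H'; congruence.
- intros a a' b H H'; apply in_cup in H, H'; rewrite in_start in H, H'.
  destruct H as [H|H], H' as [H'|H'].
  + eauto.
  + apply pair_inj in H'; destruct H' as [_ ->]; apply Hl, Hn in H; lia.
  + apply pair_inj in H; destruct H as [_ ->]; apply Hl, Hn in H'; lia.
  + apply pair_inj in H, H'; destruct H, H'; congruence.
Qed.

Lemma family_forced G q : generic M cohen G -> q ∈ I ->
  exists r i, r ∈ I /\ q ⊆ r /\
    forces_mem inj_omega r (chk (real G (num i))) (val G family_name).
Proof.
intros hG Hq; destruct (extend_start Hq) as (r & n & Hr & L1 & L2).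
assert (GE : empty ∈ G)
  by (apply (empty_generic hG empty_P); intro; apply empty_subset).
destruct (some_real_contains hG n) as [i Hi]; exists r, i.
split; [exact Hr|]; split; [exact L1|]; intros u Hu Lu; exists u.
split; [exact Hu|]; split; [intros z Hz; exact Hz|].
exists (start (num n)), (chk (real G (num i))); split; [|split].
- apply in_family; [exact GE|apply hG|eauto].
- intros z Hz; exact (Lu z (L2 z Hz)).
- apply forces_eq_refl, M_inj_omega.
Qed.

End Model.

Theorem theorem6 (M : V -> Prop) (G : V) (hM : ctm M) (hG : generic M cohen G) :
  ~ maximum_principle (basic_cohen_model M G) inj_omega.
Proof.
intro MP.
assert (GE : empty ∈ G)
  by (apply (empty_generic hG empty_P); intro; apply empty_subset).
assert (GP : G ⊆ cond cohen) by apply hG.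
assert (Nreal : forall i, name_in (basic_cohen_model M G) inj_omega (chk (real G (num i)))).
{ intro i; split; [|apply name_chk, empty_I].
  exists (real_name (num i)); rewrite (val_real_name hM) by (assumption || apply M_num, hM).
  split; [apply M_real_name, M_num; exact hM|].
  split; [apply (name_real_name hM), M_num, hM|].
  split; [apply (hs_real_name hM)|reflexivity]. }
assert (Nfam : name_in (basic_cohen_model M G) inj_omega (val G family_name)).
{ split.
  - exists family_name; split; [apply (family_name_spec hM)|].
    split; [apply (name_family_name hM)|split; [apply (hs_family_name hM)|reflexivity]].
  - constructor; intros w Hw; apply (in_family hM) in Hw; [|assumption|assumption].
    destruct Hw as (i & n & _ & ->); exists (start (num n)), (chk (real G (num i))).
    split; [apply start_I|split; [apply (Nreal i)|reflexivity]]. }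
(* Index 0 is the witness and every other index is sent to the family, so [Mem 0 1] puts the witness
   into the family. *)
destruct (proj1 (MP empty (Mem 0 1) (fun _ => val G family_name) empty_I (fun _ => Nfam)))
  as (t & [(x & Mx & Nx & Sx & ->) Nt] & Ft).
{ intros q Hq _; destruct (family_forced hM hG Hq) as (r & i & Hr & L & F).
  exists r; split; [exact Hr|]; split; [exact L|]; exists (chk (real G (num i))).
  split; [apply Nreal|exact F]. }
simpl in Ft; destruct Sx as [x [k Hk] _].
destruct (reals_omit hM hG k) as [n Hn].
destruct (Ft (start (num n)) (start_I n) (@empty_subset _))
  as (r & Hr & Lr & p2 & s2 & Hps & Lp2 & Feq).
apply (in_family hM) in Hps; [|assumption|assumption].
destruct Hps as (i & n' & Hi & E); apply pair_inj in E; destruct E as [-> ->].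
(* The condition [r] extends both starting conditions and is single-valued at 0. *)
assert (E : num n = num n').
{ assert (Hr' := Hr); simpl in Hr'; apply in_Inj in Hr'; destruct Hr' as (_ & _ & Hsv & _).
  apply (Hsv empty); [apply Lr|apply Lp2]; apply in_start; reflexivity. }
rewrite <- E in Hi.
assert (Hki : k <= i) by (destruct (Nat.le_gt_cases k i); [assumption|destruct (Hn i); assumption]).
destruct (generic_extension hM hG Hr) as (H & HH & HrH & HGH & Hval).
assert (HE : empty ∈ H).
{ destruct HH as (_ & (h & Hh) & U & _).
  exact (U h empty Hh empty_I (@empty_subset _)). }
assert (Mi : forall j, M (num j)) by exact (M_num hM).
assert (Mreal : forall j, M (real_name (num j))) by (intro; apply M_real_name, Mi; exact hM).
assert (Vreal : forall j, val G (real_name (num j)) = chk (real G (num j)))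
  by (intro j; apply (val_real_name hM); auto).
assert (Exi : val H (val G x) = val H (val G (real_name (num i)))).
{ apply (Hval x (real_name (num i)) r); auto; rewrite Vreal; [apply Nreal|exact Feq]. }
destruct (double_value_decided hM Mx (Mreal i) hG HGH Exi) as (p & b & Gp & Hb & Hdec).
destruct (swap_generic hM hG i Gp) as (j & Hij & Gj).
assert (Hs := group_gen Hij).
assert (HGH' := generic_swap hM Hij (proj1 hG) HH HGH).
assert (Gf := filter_act Hs (proj1 hG)).
assert (E' := Hdec _ _ (generic_fst hM Gf HGH') HGH').
(* As k <= i < j, the swap fixes all numbers below [k], hence it fixes [x]. *)
rewrite <- (Hk (swap i j)) in E'.
2:{ split; [exact Hs|]; intros l Hl; apply swap_other; lia. }
(* Both sides are now swapped names evaluated by the swapped filter, so [val_act] returns to [G],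
   with [j] in place of [i] for the real but the same [x]. *)
assert (Er : real_name (num i) = act (swap i j) (real_name (num j)))
  by (rewrite (act_real_name hM Hs), swap_r; reflexivity).
rewrite Er, !val_act in E'; auto; [|apply (name_real_name hM); auto].
rewrite Exi, !Vreal, !val_chk in E' by exact HE.
apply (real_injective hM hG (i := i) (j := j)); [lia|]; apply E'; [|exact Hb].
(* The swapped [p] lies in [G], and swapping it again gives [p]; thus [p] belongs to the swapped
   filter. *)
apply in_act_filter; exists (act_cond (swap i j) p); split; [exact Gj|].
symmetry; apply act_cond_inv; [apply swap_invol|apply GP, Gp].
Qed.
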